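(* There is a uniform effective procedure which, given (as an oracle) a linear ordering $\mathcal{L}$ with universe $\omega$, produces a set $A = A_{\mathcal{L}} \subseteq \omega$ whose complement is c.e. in $\mathcal{L}$ (uniformly in $\mathcal{L}$), such that: if $\mathcal{L}$ is well-founded then $A$ is uniformly introreducible, and if $\mathcal{L}$ is ill-founded then $A$ is not introreducible.
   Context: An infinite set $A\subseteq\omega$ is introreducible if every infinite subset of $A$ computes $A$; it is uniformly introreducible if there is a single Turing functional $\Phi$ with $\Phi(S)=A$ for every infinite $S\subseteq A$. *)

(* Defs.v *)
From Stdlib Require Import Arith Cantor.

Inductive code : Type :=
| CZero
| CSucc
| CId
| CFst
| CSnd
| COracle
| CComp (f g : code)
| CPair (f g : code)
| CRec (f g : code)
| CMu (f : code).

Definition pair (a b : nat) : nat := Cantor.to_nat (a, b).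
Definition fst_of (n : nat) : nat := fst (Cantor.of_nat n).
Definition snd_of (n : nat) : nat := snd (Cantor.of_nat n).

Inductive eval (X : nat -> bool) : code -> nat -> nat -> Prop :=
| ev_zero x : eval X CZero x 0
| ev_succ x : eval X CSucc x (S x)
| ev_id x : eval X CId x x
| ev_fst x : eval X CFst x (fst_of x)
| ev_snd x : eval X CSnd x (snd_of x)
| ev_oracle x : eval X COracle x (if X x then 1 else 0)
| ev_comp f g x y z : eval X g x y -> eval X f y z -> eval X (CComp f g) x z
| ev_pair f g x y z : eval X f x y -> eval X g x z -> eval X (CPair f g) x (pair y z)
| ev_rec0 f g x y : eval X f x y -> eval X (CRec f g) (pair x 0) y
| ev_recS f g x n y z :
    eval X (CRec f g) (pair x n) y -> eval X g (pair x (pair n y)) z ->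
    eval X (CRec f g) (pair x (S n)) z
| ev_mu f x n :
    eval X f (pair x n) 0 ->
    (forall m, m < n -> exists k, eval X f (pair x m) (S k)) ->
    eval X (CMu f) x n.

Definition halts (X : nat -> bool) (e : code) (x : nat) : Prop :=
  exists y, eval X e x y.

Definition computes_with (e : code) (X : nat -> bool) (A : nat -> Prop) : Prop :=
  forall n, (A n -> eval X e n 1) /\ (~ A n -> eval X e n 0).

Definition Turing_computes (X : nat -> bool) (A : nat -> Prop) : Prop :=
  exists e, computes_with e X A.

Definition infinite_set (A : nat -> Prop) : Prop :=
  forall m, exists n, m <= n /\ A n.

Definition subset_of (S : nat -> bool) (A : nat -> Prop) : Prop :=
  forall n, S n = true -> A n.

Definition infinite_b (S : nat -> bool) : Prop := infinite_set (fun n => S n = true).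

Definition introreducible (A : nat -> Prop) : Prop :=
  infinite_set A /\
  forall S : nat -> bool, subset_of S A -> infinite_b S -> Turing_computes S A.

Definition uniformly_introreducible (A : nat -> Prop) : Prop :=
  infinite_set A /\
  exists e : code, forall S : nat -> bool,
    subset_of S A -> infinite_b S -> computes_with e S A.

Definition is_linear_order (le : nat -> nat -> bool) : Prop :=
  (forall a, le a a = true) /\
  (forall a b, le a b = true -> le b a = true -> a = b) /\
  (forall a b c, le a b = true -> le b c = true -> le a c = true) /\
  (forall a b, le a b = true \/ le b a = true).

Definition strict (le : nat -> nat -> bool) (a b : nat) : Prop :=
  le a b = true /\ a <> b.

Definition order_oracle (le : nat -> nat -> bool) (n : nat) : bool :=
  le (fst_of n) (snd_of n).

(* Main.v *)
Require Import Defs.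
From Stdlib Require Import Arith Wellfounded Cantor Lia Bool Classical ClassicalEpsilon.

(** The elements of A are codes [pair s h] of stages s, where h is the history of the
    ordering L below s; hence every infinite subset of A computes L. Even stages carry
    labels from the ordering of finite subsets of L compared at the largest difference
    (a copy of 2^L), which is well-founded if L is and contains a dense ordering if L is
    not. Odd stages are used for diagonalization. The odd stage x of rank p is assigned the
    p-th requirement, and may be the target of a later event t: a finite set K of even
    stages, with strictly decreasing labels, as an oracle for which the machine of the
    requirement says that x is in A. The event removes everything in [x, t) outside K.

    If x < y are in A and the label of y is not below that of x, then no later event can
    keep both, so A is settled up to x at stage y. If L is well-founded, every infinite
    subset of A contains such pairs, arbitrarily far out, and they decide A. If L is
    ill-founded, an infinite subset S of A with descending labels is built by forcing: the
    labels still available form an ill-founded interval of 2^L, which splits into two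
    ill-founded intervals. Given a machine, either an event with labels in the upper part
    makes it wrong about its target, and S continues from the K of the event into the lower
    part; or there is no such event, and S stays in the upper part for good, so that the
    machine never recognizes an actual element of A. *)

(** * Computable functions relative to a family of oracles *)

Lemma fst_pair a b : fst_of (pair a b) = a.
Proof. unfold fst_of, pair. now rewrite Cantor.cancel_of_to. Qed.

Lemma snd_pair a b : snd_of (pair a b) = b.
Proof. unfold snd_of, pair. now rewrite Cantor.cancel_of_to. Qed.

Lemma pair_fst_snd n : pair (fst_of n) (snd_of n) = n.
Proof.
  unfold fst_of, snd_of, pair. rewrite <- surjective_pairing.
  apply Cantor.cancel_to_of.
Qed.

Lemma pair_ge a b : b + a <= pair a b.
Proof. apply Cantor.to_nat_non_decreasing. Qed.

Lemma fst_of_le n : fst_of n <= n.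
Proof. rewrite <- (pair_fst_snd n) at 2. pose proof (pair_ge (fst_of n) (snd_of n)). lia. Qed.

Lemma snd_of_le n : snd_of n <= n.
Proof. rewrite <- (pair_fst_snd n) at 2. pose proof (pair_ge (fst_of n) (snd_of n)). lia. Qed.

Global Opaque pair fst_of snd_of.

Definition primrec (b : nat) (s : nat -> nat -> nat) (n : nat) : nat :=
  nat_rect (fun _ => nat) b s n.

Lemma primrec_S b s n : primrec b s (S n) = s n (primrec b s n).
Proof. reflexivity. Qed.

Definition ball (n : nat) (f : nat -> bool) : bool :=
  nat_rect (fun _ => bool) true (fun k r => r && f k) n.

Definition bex (n : nat) (f : nat -> bool) : bool := negb (ball n (fun k => negb (f k))).

Definition count (f : nat -> bool) (n : nat) : nat :=
  primrec 0 (fun k r => r + Nat.b2n (f k)) n.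

Lemma ball_true n f : ball n f = true <-> forall k, k < n -> f k = true.
Proof.
  induction n as [|n IH]; simpl.
  - split; [intros _ k Hk; lia | reflexivity].
  - rewrite andb_true_iff, IH. split.
    + intros [H1 H2] k Hk. destruct (Nat.eq_dec k n) as [->|]; [easy|]. apply H1; lia.
    + intros H. split; [intros; apply H; lia | apply H; lia].
Qed.

Lemma bex_true n f : bex n f = true <-> exists k, k < n /\ f k = true.
Proof.
  unfold bex. rewrite negb_true_iff. split.
  - intros H. apply NNPP. intros N.
    assert (ball n (fun k => negb (f k)) = true); [|congruence].
    apply ball_true. intros k Hk. destruct (f k) eqn:E; [|easy].
    exfalso. apply N. now exists k.
  - intros [k [Hk Hf]]. destruct (ball n _) eqn:E; [|easy].
    rewrite ball_true in E. specialize (E k Hk). now rewrite Hf in E.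
Qed.

Lemma ball_ext n f g : (forall k, k < n -> f k = g k) -> ball n f = ball n g.
Proof.
  induction n as [|n IH]; intros H; simpl; [easy|].
  rewrite IH, H; [easy|lia|]. intros; apply H; lia.
Qed.

Lemma count_ext n f g : (forall k, k < n -> f k = g k) -> count f n = count g n.
Proof.
  induction n as [|n IH]; intros H; unfold count; simpl; [easy|].
  change (count f n + Nat.b2n (f n) = count g n + Nat.b2n (g n)).
  rewrite IH, H; [easy|lia|]. intros; apply H; lia.
Qed.

Lemma count_S f n : count f (S n) = count f n + Nat.b2n (f n).
Proof. reflexivity. Qed.

Lemma count_false f m n :
  m <= n -> (forall k, m <= k < n -> f k = false) -> count f n = count f m.
Proof.
  intros Hmn H. induction Hmn as [|n Hmn IH]; [easy|].
  rewrite count_S, IH, H; [simpl; lia|lia|]. intros; apply H; lia.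
Qed.

Lemma count_le f n : count f n <= n.
Proof.
  induction n as [|n IH]; [easy|]. rewrite count_S. destruct (f n); simpl; lia.
Qed.

(** [r] codes a sequence of length [t] as nested pairs, last entry outermost; [t - S k] first
    projections strip the entries after position [k]. *)
Definition lookup (t r k : nat) : nat :=
  snd_of (primrec r (fun _ => fst_of) (t - S k)).

Fixpoint history (f : nat -> bool) (t : nat) : nat :=
  match t with
  | 0 => 0
  | S t => pair (history f t) (Nat.b2n (f t))
  end.

Lemma primrec_shift g r n :
  primrec r (fun _ => g) (S n) = primrec (g r) (fun _ => g) n.
Proof.
  induction n as [|n IH]; [easy|].
  change (g (primrec r (fun _ => g) (S n)) = g (primrec (g r) (fun _ => g) n)).
  now rewrite IH.
Qed.

Lemma lookup_S t r b k : k < t -> lookup (S t) (pair r b) k = lookup t r k.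
Proof.
  intros Hk. unfold lookup. replace (S t - S k) with (S (t - S k)) by lia.
  now rewrite primrec_shift, fst_pair.
Qed.

Lemma lookup_last t r b : lookup (S t) (pair r b) t = b.
Proof. unfold lookup. rewrite Nat.sub_diag. simpl. apply snd_pair. Qed.

Lemma lookup_history f t k : k < t -> lookup t (history f t) k = Nat.b2n (f k).
Proof.
  induction t as [|t IH]; [lia|]. intros Hk. simpl.
  destruct (Nat.eq_dec k t) as [->|]; [apply lookup_last|].
  rewrite lookup_S by lia. apply IH. lia.
Qed.

Section Computability.

Context {I : Type} (X : I -> nat -> bool).

(** One code must serve all indices [i], so uniformity in the oracle is built in. The index will
    range over all oracles, and later over all infinite subsets of [A]. *)
Definition computable (F : I -> nat -> nat) : Prop :=
  exists c, forall i x, eval (X i) c x (F i x).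

Definition decidable (B : I -> nat -> bool) : Prop :=
  computable (fun i n => Nat.b2n (B i n)).

Lemma computable_ext F G :
  (forall i n, F i n = G i n) -> computable F -> computable G.
Proof. intros E [c Hc]. exists c. intros i x. rewrite <- E. apply Hc. Qed.

Lemma computable_comp G F :
  computable G -> computable F -> computable (fun i n => G i (F i n)).
Proof. intros [g Hg] [f Hf]. exists (CComp g f). intros. econstructor; eauto. Qed.

Lemma computable_id : computable (fun _ n => n).
Proof. exists CId. constructor. Qed.

Lemma computable_succ F : computable F -> computable (fun i n => S (F i n)).
Proof. apply (computable_comp (fun _ n => S n)). exists CSucc. constructor. Qed.

Lemma computable_const k : computable (fun _ _ => k).
Proof. induction k; [exists CZero; constructor | now apply computable_succ]. Qed.

Lemma computable_fst F : computable F -> computable (fun i n => fst_of (F i n)).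
Proof. apply (computable_comp (fun _ n => fst_of n)). exists CFst. constructor. Qed.

Lemma computable_snd F : computable F -> computable (fun i n => snd_of (F i n)).
Proof. apply (computable_comp (fun _ n => snd_of n)). exists CSnd. constructor. Qed.

Lemma computable_pair F G :
  computable F -> computable G -> computable (fun i n => pair (F i n) (G i n)).
Proof. intros [f Hf] [g Hg]. exists (CPair f g). intros. now constructor. Qed.

Lemma decidable_comp B F :
  decidable B -> computable F -> decidable (fun i n => B i (F i n)).
Proof. apply (computable_comp (fun i n => Nat.b2n (B i n))). Qed.

Lemma decidable_oracle : decidable X.
Proof.
  exists COracle. intros i x. replace (Nat.b2n (X i x)) with (if X i x then 1 else 0).
  - constructor.
  - now destruct (X i x).
Qed.

Lemma computable_primrec B s N :
  computable B ->
  computable (fun i m => s i (fst_of m) (fst_of (snd_of m)) (snd_of (snd_of m))) ->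
  computable N ->
  computable (fun i n => primrec (B i n) (s i n) (N i n)).
Proof.
  intros [b Hb] [c Hc] [d Hd]. exists (CComp (CRec b c) (CPair CId d)). intros i x.
  apply ev_comp with (pair x (N i x)); [constructor; [constructor|apply Hd]|].
  induction (N i x) as [|k IH]; [constructor; apply Hb|].
  apply ev_recS with (1 := IH). simpl.
  specialize (Hc i (pair x (pair k (primrec (B i x) (s i x) k)))).
  rewrite fst_pair, snd_pair, fst_pair, snd_pair in Hc. exact Hc.
Qed.

Lemma computable_if B F G :
  decidable B -> computable F -> computable G ->
  computable (fun i n => if B i n then F i n else G i n).
Proof.
  intros HB HF HG.
  apply computable_ext with (fun i n => primrec (G i n) (fun _ _ => F i n) (Nat.b2n (B i n))).
  - intros i n. now destruct (B i n).
  - apply computable_primrec with (s := fun i n _ _ => F i n); [easy| |easy].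
    apply (computable_comp F); [easy|]. apply computable_fst, computable_id.
Qed.

Lemma decidable_if B C D :
  decidable B -> decidable C -> decidable D ->
  decidable (fun i n => if B i n then C i n else D i n).
Proof.
  intros HB HC HD. eapply computable_ext; [|exact (computable_if _ _ _ HB HC HD)].
  intros i n. simpl. now destruct (B i n).
Qed.

Lemma decidable_true : decidable (fun _ _ => true).
Proof. exact (computable_const 1). Qed.

Lemma decidable_false : decidable (fun _ _ => false).
Proof. exact (computable_const 0). Qed.

Lemma decidable_negb B : decidable B -> decidable (fun i n => negb (B i n)).
Proof. intros H. exact (decidable_if _ _ _ H decidable_false decidable_true). Qed.

Lemma decidable_andb B C :
  decidable B -> decidable C -> decidable (fun i n => B i n && C i n).
Proof. intros HB HC. exact (decidable_if _ _ _ HB HC decidable_false). Qed.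

Lemma decidable_orb B C :
  decidable B -> decidable C -> decidable (fun i n => B i n || C i n).
Proof. intros HB HC. exact (decidable_if _ _ _ HB decidable_true HC). Qed.

Lemma decidable_eqb B C :
  decidable B -> decidable C -> decidable (fun i n => Bool.eqb (B i n) (C i n)).
Proof.
  intros HB HC. eapply computable_ext;
    [|exact (decidable_if _ _ _ HB HC (decidable_negb _ HC))].
  intros i n. simpl. now destruct (B i n), (C i n).
Qed.

Lemma computable_pred F : computable F -> computable (fun i n => Nat.pred (F i n)).
Proof.
  intros H. apply computable_ext with (fun i n => primrec 0 (fun k _ => k) (F i n)).
  - intros i n. now destruct (F i n).
  - apply computable_primrec with (s := fun _ _ k _ => k);
      [apply computable_const| |easy].
    apply computable_fst, computable_snd, computable_id.
Qed.

Lemma computable_add F G :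
  computable F -> computable G -> computable (fun i n => F i n + G i n).
Proof.
  intros HF HG.
  apply computable_ext with (fun i n => primrec (F i n) (fun _ => S) (G i n)).
  - intros i n. induction (G i n) as [|k IH]; [unfold primrec; simpl; lia|rewrite primrec_S, IH; cbv beta; lia].
  - apply computable_primrec with (s := fun _ _ _ r => S r); [easy| |easy].
    apply computable_succ, computable_snd, computable_snd, computable_id.
Qed.

Lemma computable_sub F G :
  computable F -> computable G -> computable (fun i n => F i n - G i n).
Proof.
  intros HF HG.
  apply computable_ext with (fun i n => primrec (F i n) (fun _ => Nat.pred) (G i n)).
  - intros i n. induction (G i n) as [|k IH]; [unfold primrec; simpl; lia|rewrite primrec_S, IH; cbv beta; lia].
  - apply computable_primrec with (s := fun _ _ _ r => Nat.pred r); [easy| |easy].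
    apply computable_pred, computable_snd, computable_snd, computable_id.
Qed.

Lemma decidable_leb F G :
  computable F -> computable G -> decidable (fun i n => F i n <=? G i n).
Proof.
  intros HF HG. apply computable_ext with (fun i n => 1 - (F i n - G i n)).
  - intros i n. destruct (Nat.leb_spec (F i n) (G i n)); cbn [Nat.b2n]; lia.
  - apply computable_sub; [apply computable_const|now apply computable_sub].
Qed.

Lemma decidable_ltb F G :
  computable F -> computable G -> decidable (fun i n => F i n <? G i n).
Proof. intros HF HG. apply decidable_leb; [now apply computable_succ|easy]. Qed.

Lemma decidable_nat_eqb F G :
  computable F -> computable G -> decidable (fun i n => F i n =? G i n).
Proof.
  intros HF HG.
  apply computable_ext with (fun i n => Nat.b2n ((F i n <=? G i n) && (G i n <=? F i n))).
  - intros i n. f_equal. apply eq_iff_eq_true.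
    rewrite andb_true_iff, !Nat.leb_le, Nat.eqb_eq. lia.
  - apply decidable_andb; now apply decidable_leb.
Qed.

Lemma decidable_ball N B :
  computable N -> decidable (fun i m => B i (fst_of m) (snd_of m)) ->
  decidable (fun i n => ball (N i n) (B i n)).
Proof.
  intros HN HB.
  apply computable_ext with
    (fun i n => primrec 1 (fun k r => if B i n k then r else 0) (N i n)).
  - intros i n. induction (N i n) as [|k IH]; [easy|].
    rewrite primrec_S, IH. simpl. destruct (ball k (B i n)), (B i n k); easy.
  - apply computable_primrec with (s := fun i n k r => if B i n k then r else 0);
      [apply computable_const| |easy].
    apply computable_if; [| |apply computable_const].
    + eapply computable_ext; [|apply (computable_comp _ (fun _ m => pair (fst_of m) (fst_of (snd_of m))) HB)].
      * intros i n. simpl. now rewrite fst_pair, snd_pair.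
      * apply computable_pair; [|apply computable_fst, computable_snd, computable_id].
        apply computable_fst, computable_id.
    + apply computable_snd, computable_snd, computable_id.
Qed.

Lemma decidable_bex N B :
  computable N -> decidable (fun i m => B i (fst_of m) (snd_of m)) ->
  decidable (fun i n => bex (N i n) (B i n)).
Proof.
  intros HN HB. apply decidable_negb.
  apply decidable_ball with (B := fun i n k => negb (B i n k)); [easy|].
  now apply decidable_negb.
Qed.

Lemma decidable_odd F : computable F -> decidable (fun i n => Nat.odd (F i n)).
Proof.
  intros H. apply computable_ext with (fun i n => primrec 0 (fun _ r => 1 - r) (F i n)).
  - intros i n. induction (F i n) as [|k IH]; [easy|].
    rewrite primrec_S, IH, Nat.odd_succ, <- Nat.negb_odd. now destruct (Nat.odd k).
  - apply computable_primrec with (s := fun _ _ _ r => 1 - r);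
      [apply computable_const| |easy].
    apply computable_sub; [apply computable_const|].
    apply computable_snd, computable_snd, computable_id.
Qed.

Lemma computable_div2 F : computable F -> computable (fun i n => Nat.div2 (F i n)).
Proof.
  intros H.
  apply computable_ext with
    (fun i n => primrec 0 (fun k r => r + Nat.b2n (Nat.odd k)) (F i n)).
  - intros i n. induction (F i n) as [|k IH]; [easy|].
    change (primrec 0 (fun k r => r + Nat.b2n (Nat.odd k)) k + Nat.b2n (Nat.odd k)
            = Nat.div2 (S k)).
    rewrite IH. pose proof (Nat.div2_odd k). pose proof (Nat.div2_odd (S k)).
    rewrite Nat.odd_succ, <- Nat.negb_odd in H1.
    destruct (Nat.odd k); cbn [negb Nat.b2n] in *; lia.
  - apply computable_primrec with (s := fun _ _ k r => r + Nat.b2n (Nat.odd k));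
      [apply computable_const| |easy].
    apply computable_add; [apply computable_snd, computable_snd, computable_id|].
    apply decidable_odd, computable_fst, computable_snd, computable_id.
Qed.

Lemma decidable_testbit F G :
  computable F -> computable G -> decidable (fun i n => Nat.testbit (F i n) (G i n)).
Proof.
  intros HF HG.
  apply computable_ext with
    (fun i n => Nat.b2n (Nat.odd (primrec (F i n) (fun _ => Nat.div2) (G i n)))).
  - intros i n. f_equal. generalize (F i n). induction (G i n) as [|k IH]; intros a.
    + now rewrite Nat.bit0_odd.
    + rewrite primrec_shift, IH. reflexivity.
  - apply decidable_odd.
    apply computable_primrec with (s := fun _ _ _ r => Nat.div2 r); [easy| |easy].
    apply computable_div2, computable_snd, computable_snd, computable_id.
Qed.

Lemma computable_count N B :
  computable N -> decidable (fun i m => B i (fst_of m) (snd_of m)) ->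
  computable (fun i n => count (B i n) (N i n)).
Proof.
  intros HN HB.
  apply computable_primrec with (s := fun i n k r => r + Nat.b2n (B i n k));
    [apply computable_const| |easy].
  apply computable_add; [apply computable_snd, computable_snd, computable_id|].
  eapply computable_ext; [|apply (computable_comp _ (fun _ m => pair (fst_of m) (fst_of (snd_of m))) HB)].
  - intros i n. simpl. now rewrite fst_pair, snd_pair.
  - apply computable_pair; [|apply computable_fst, computable_snd, computable_id].
    apply computable_fst, computable_id.
Qed.

Lemma computable_lookup T R K :
  computable T -> computable R -> computable K ->
  computable (fun i n => lookup (T i n) (R i n) (K i n)).
Proof.
  intros HT HR HK. apply computable_snd.
  apply computable_primrec with (s := fun _ _ _ r => fst_of r); [easy| |].
  - apply computable_fst, computable_snd, computable_snd, computable_id.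
  - apply computable_sub; [easy|now apply computable_succ].
Qed.

Lemma computable_mu B G :
  decidable B ->
  (forall i n, B i (pair n (G i n)) = true /\ forall m, m < G i n -> B i (pair n m) = false) ->
  computable G.
Proof.
  intros HB HG. destruct (decidable_negb _ HB) as [c Hc]. exists (CMu c). intros i n.
  destruct (HG i n) as [H1 H2]. constructor.
  - specialize (Hc i (pair n (G i n))). now rewrite H1 in Hc.
  - intros m Hm. exists 0. specialize (Hc i (pair n m)). now rewrite (H2 m Hm) in Hc.
Qed.

End Computability.

(** * Automation of computability proofs *)

Ltac comp_hook := fail.

Ltac comp_step :=
  cbv beta;
  lazymatch goal with
  | |- decidable _ (fun _ _ => true) => apply decidable_true
  | |- decidable _ (fun _ _ => false) => apply decidable_false
  | |- decidable ?X (fun i n => negb (@?B i n)) => apply (decidable_negb X B)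
  | |- decidable ?X (fun i n => andb (@?B i n) (@?C i n)) => apply (decidable_andb X B C)
  | |- decidable ?X (fun i n => orb (@?B i n) (@?C i n)) => apply (decidable_orb X B C)
  | |- decidable ?X (fun i n => Bool.eqb (@?B i n) (@?C i n)) => apply (decidable_eqb X B C)
  | |- decidable ?X (fun i n => Nat.leb (@?B i n) (@?C i n)) => apply (decidable_leb X B C)
  | |- decidable ?X (fun i n => Nat.ltb (@?B i n) (@?C i n)) => apply (decidable_ltb X B C)
  | |- decidable ?X (fun i n => Nat.eqb (@?B i n) (@?C i n)) => apply (decidable_nat_eqb X B C)
  | |- decidable ?X (fun i n => Nat.odd (@?B i n)) => apply (decidable_odd X B)
  | |- decidable ?X (fun i n => Nat.testbit (@?B i n) (@?C i n)) =>
      apply (decidable_testbit X B C)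
  | |- decidable ?X (fun i n => ball (@?N i n) (@?B i n)) => apply (decidable_ball X N B)
  | |- decidable ?X (fun i n => bex (@?N i n) (@?B i n)) => apply (decidable_bex X N B)
  | |- computable ?X (fun _ n => n) => apply (computable_id X)
  | |- computable ?X (fun _ _ => ?k) => apply (computable_const X k)
  | |- computable ?X (fun i n => Nat.b2n (@?B i n)) => change (decidable X B)
  | |- computable ?X (fun i n => S (@?F i n)) => apply (computable_succ X F)
  | |- computable ?X (fun i n => fst_of (@?F i n)) => apply (computable_fst X F)
  | |- computable ?X (fun i n => snd_of (@?F i n)) => apply (computable_snd X F)
  | |- computable ?X (fun i n => pair (@?F i n) (@?G i n)) => apply (computable_pair X F G)
  | |- computable ?X (fun i n => Nat.add (@?F i n) (@?G i n)) => apply (computable_add X F G)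
  | |- computable ?X (fun i n => Nat.sub (@?F i n) (@?G i n)) => apply (computable_sub X F G)
  | |- computable ?X (fun i n => Nat.pred (@?F i n)) => apply (computable_pred X F)
  | |- computable ?X (fun i n => Nat.div2 (@?F i n)) => apply (computable_div2 X F)
  | |- computable ?X (fun i n => count (@?B i n) (@?N i n)) => apply (computable_count X N B)
  | |- computable ?X (fun i n => lookup (@?T i n) (@?R i n) (@?K i n)) =>
      apply (computable_lookup X T R K)
  | |- computable ?X (fun i n => primrec (@?B i n) (@?s i n) (@?N i n)) =>
      apply (computable_primrec X B s N)
  | |- computable ?X (fun i n => if @?B i n then @?F i n else @?G i n) =>
      apply (computable_if X B F G)
  | _ => comp_hook
  end.

Ltac comp := repeat comp_step.

(** * A stack machine for codes *)

(* Configurations are numbers: a return or evaluation request paired with a stack, where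
   [0] is the empty stack. *)
Definition push (f k : nat) : nat := S (pair f k).
Definition ret (v k : nat) : nat := pair (pair 1 v) k.
Definition enter (c x k : nat) : nat := pair (pair 0 (pair c x)) k.

Fixpoint enc (c : code) : nat :=
  match c with
  | CZero => pair 0 0
  | CSucc => pair 1 0
  | CId => pair 2 0
  | CFst => pair 3 0
  | CSnd => pair 4 0
  | COracle => pair 5 0
  | CComp f g => pair 6 (pair (enc f) (enc g))
  | CPair f g => pair 7 (pair (enc f) (enc g))
  | CRec f g => pair 8 (pair (enc f) (enc g))
  | CMu f => pair 9 (enc f)
  end.

Definition step_enter (o : bool) (t a c x k : nat) : nat :=
  if t =? 0 then ret 0 k
  else if t =? 1 then ret (S x) k
  else if t =? 2 then ret x k
  else if t =? 3 then ret (fst_of x) k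
  else if t =? 4 then ret (snd_of x) k
  else if t =? 5 then ret (Nat.b2n o) k
  else if t =? 6 then enter (snd_of a) x (push (pair 0 (fst_of a)) k)
  else if t =? 7 then enter (fst_of a) x (push (pair 1 (pair (snd_of a) x)) k)
  else if t =? 8 then
    if snd_of x =? 0 then enter (fst_of a) (fst_of x) k
    else enter c (pair (fst_of x) (Nat.pred (snd_of x)))
           (push (pair 2 (pair (snd_of a) (pair (fst_of x) (Nat.pred (snd_of x))))) k)
  else enter a (pair x 0) (push (pair 3 (pair a (pair x 0))) k).

(** The tag [t] of the top frame says what awaits [v]: 0 the outer function of a composition, 1 the
    second component of a pair, 2 a recursion step, 3 a minimization, and otherwise a finished first
    component. *)
Definition step_ret (v t a k : nat) : nat :=
  if t =? 0 then enter a v k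
  else if t =? 1 then enter (fst_of a) (snd_of a) (push (pair 4 v) k)
  else if t =? 2 then
    enter (fst_of a) (pair (fst_of (snd_of a)) (pair (snd_of (snd_of a)) v)) k
  else if t =? 3 then
    if v =? 0 then ret (snd_of (snd_of a)) k
    else enter (fst_of a) (pair (fst_of (snd_of a)) (S (snd_of (snd_of a))))
           (push (pair 3 (pair (fst_of a)
                                (pair (fst_of (snd_of a)) (S (snd_of (snd_of a)))))) k)
  else ret (pair a v) k.

(** The oracle enters only through the bit [o], which makes the finite use of a run visible.
    Returning with an empty stack is a fixed point, so longer runs do not spoil a result. *)
Definition step (o : bool) (s : nat) : nat :=
  if fst_of (fst_of s) =? 0 then
    step_enter o (fst_of (fst_of (snd_of (fst_of s)))) (snd_of (fst_of (snd_of (fst_of s))))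
      (fst_of (snd_of (fst_of s))) (snd_of (snd_of (fst_of s))) (snd_of s)
  else if snd_of s =? 0 then s
  else step_ret (snd_of (fst_of s)) (fst_of (fst_of (Nat.pred (snd_of s))))
         (snd_of (fst_of (Nat.pred (snd_of s)))) (snd_of (Nat.pred (snd_of s))).

Definition query (s : nat) : nat := snd_of (snd_of (fst_of s)).

Definition run (O : nat -> bool) (n s : nat) : nat :=
  primrec s (fun _ r => step (O (query r)) r) n.

Lemma run_add O m n s : run O (n + m) s = run O n (run O m s).
Proof.
  induction n as [|n IH]; [easy|].
  change (step (O (query (run O (n + m) s))) (run O (n + m) s)
          = step (O (query (run O n (run O m s)))) (run O n (run O m s))).
  now rewrite IH.
Qed.

Definition reaches (O : nat -> bool) (s s' : nat) : Prop := exists n, run O n s = s'.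

Lemma reaches_trans O s1 s2 s3 : reaches O s1 s2 -> reaches O s2 s3 -> reaches O s1 s3.
Proof. intros [n <-] [m <-]. exists (m + n). apply run_add. Qed.

Lemma reaches_step O s s' s'' :
  step (O (query s)) s = s' -> reaches O s' s'' -> reaches O s s''.
Proof. intros E. apply reaches_trans. now exists 1. Qed.

Lemma step_enter_eq o t a x k :
  step o (enter (pair t a) x k) = step_enter o t a (pair t a) x k.
Proof. unfold step, enter. now repeat (rewrite fst_pair || rewrite snd_pair). Qed.

Lemma step_ret_eq o v t a k : step o (ret v (push (pair t a) k)) = step_ret v t a k.
Proof.
  unfold step, ret, push.
  now repeat (rewrite fst_pair || rewrite snd_pair || cbn [Nat.eqb Nat.pred]).
Qed.

Lemma query_enter c x k : query (enter c x k) = x.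
Proof. unfold query, enter. now rewrite fst_pair, !snd_pair. Qed.

Ltac machine_step :=
  eapply reaches_step;
  [ first [rewrite query_enter, step_enter_eq; unfold step_enter
          | rewrite step_ret_eq; unfold step_ret];
    simpl; rewrite ?fst_pair, ?snd_pair; simpl; rewrite ?fst_pair, ?snd_pair; reflexivity
  | ].

Lemma reaches_eval O : forall c x y, eval O c x y ->
  forall k, reaches O (enter (enc c) x k) (ret y k).
Proof.
  (* Recursion on the derivation itself, because the premises of [ev_mu] hide evaluations under an
     existential. The stack [k] stays general for nested calls. *)
  fix IH 4. intros c x y H.
  destruct H as [x|x|x|x|x|x|f g x y z Hg Hf|f g x y z Hf Hg|f g x y Hf
                |f g x n y z Hr Hg|f x n H0 Hlt]; intros k; simpl enc.
  1-5: machine_step; now exists 0.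
  - machine_step. exists 0. simpl. now destruct (O x).
  - machine_step. eapply reaches_trans; [apply (IH _ _ _ Hg)|].
    machine_step. apply (IH _ _ _ Hf).
  - machine_step. eapply reaches_trans; [apply (IH _ _ _ Hf)|].
    machine_step. eapply reaches_trans; [apply (IH _ _ _ Hg)|].
    machine_step. now exists 0.
  - machine_step. apply (IH _ _ _ Hf).
  - machine_step. eapply reaches_trans; [apply (IH _ _ _ Hr)|].
    machine_step. apply (IH _ _ _ Hg).
  - machine_step.
    assert (Hm : forall j m, j + m = n ->
      reaches O (enter (enc f) (pair x m) (push (pair 3 (pair (enc f) (pair x m))) k)) (ret n k)).
    { induction j as [|j IHj]; intros m E.
      - simpl in E. subst m. eapply reaches_trans; [apply (IH _ _ _ H0)|].
        machine_step. now exists 0.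
      - destruct (Hlt m) as [v Hv]; [lia|].
        eapply reaches_trans; [apply (IH _ _ _ Hv)|].
        machine_step. apply IHj. lia. }
    apply (Hm n 0). lia.
Qed.

Lemma run_halted O n v : run O n (ret v 0) = ret v 0.
Proof.
  induction n as [|n IH]; [easy|].
  change (step (O (query (run O n (ret v 0)))) (run O n (ret v 0)) = ret v 0).
  rewrite IH. unfold step, ret. now rewrite !fst_pair, !snd_pair.
Qed.

Lemma reaches_halt_unique O s v w : reaches O s (ret v 0) -> reaches O s (ret w 0) -> v = w.
Proof.
  intros [n Hn] [m Hm].
  assert (E : ret v 0 = ret w 0).
  { rewrite <- (run_halted O m v), <- Hn, <- run_add, Nat.add_comm, run_add, Hm.
    now rewrite run_halted. }
  apply (f_equal (fun s => snd_of (fst_of s))) in E.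
  unfold ret in E. now rewrite !fst_pair, !snd_pair in E.
Qed.

(** Both results are halting values of one run of a deterministic machine. *)
Lemma eval_functional O c x y z : eval O c x y -> eval O c x z -> y = z.
Proof.
  intros Hy Hz. apply (reaches_halt_unique O (enter (enc c) x 0)); now apply reaches_eval.
Qed.

(** The use principle: each step adds one query, and the bound collects them. *)
Lemma run_use O n s :
  exists u, forall O', (forall i, i < u -> O' i = O i) -> run O' n s = run O n s.
Proof.
  induction n as [|n [u IH]]; [now exists 0|].
  exists (u + S (query (run O n s))). intros O' H.
  change (step (O' (query (run O' n s))) (run O' n s)
          = step (O (query (run O n s))) (run O n s)).
  rewrite IH by (intros; apply H; lia). rewrite H by lia. easy.
Qed.

(** * The construction *)

(* Numbers stand for the finite sets of positions of their binary digits. *)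
Definition setlt (O : nat -> bool) (u v : nat) : bool :=
  bex v (fun a =>
    Nat.testbit v a && negb (Nat.testbit u a) &&
    ball (u + v) (fun c =>
      Bool.eqb (Nat.testbit u c) (Nat.testbit v c) || O (pair c a))).

Definition setle (O : nat -> bool) (u v : nat) : bool := (u =? v) || setlt O u v.

(* An odd number t codes an attempted event by t = 2 (target, (kept, steps)) + 1; every odd
   number that is not a valid event can itself become a target. *)
Definition target (t : nat) : nat := fst_of (Nat.div2 t).
Definition kept (t : nat) : nat := fst_of (snd_of (Nat.div2 t)).
Definition steps (t : nat) : nat := snd_of (snd_of (Nat.div2 t)).

(** No upper limit for [n] appears here; [mem] and [survives] impose [n < t]. *)
Definition kills (ev : nat -> bool) (t n : nat) : bool :=
  ev t && (target t <=? n) && negb (Nat.testbit (kept t) n).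

Definition mem (ev : nat -> bool) (n t : nat) : bool :=
  ball t (fun s => (s <=? n) || negb (kills ev s n)).

(** This count both assigns requirements to odd stages and, through [label], labels to even ones. *)
Definition rank (ev : nat -> bool) (t : nat) : nat :=
  count (fun n => Nat.odd n && mem ev n t) t.

(** The first projection takes each value infinitely often, so every label can recur arbitrarily
    late. *)
Definition label (ev : nat -> bool) (t : nat) : nat := fst_of (rank ev t).

Definition stage_code (O : nat -> bool) (t : nat) : nat := pair t (history O t).

Lemma fst_stage_code O t : fst_of (stage_code O t) = t.
Proof. apply fst_pair. Qed.

(** [K] lists stages, whereas machines query elements of A; hence the translation by
    [stage_code]. *)
Definition finite_oracle (O : nat -> bool) (K n : nat) : bool :=
  Nat.testbit K (fst_of n) && (n =? stage_code O (fst_of n)).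

Definition good_set (O ev : nat -> bool) (K t b : nat) : bool :=
  ball t (fun k => negb (Nat.testbit K k) ||
    negb (Nat.odd k) && mem ev k t && setle O b (label ev k) &&
    ball k (fun j => negb (Nat.testbit K j) || setlt O (label ev k) (label ev j))).

(* The rank of the target codes its requirement ((e, K0), (m, b)): the set kept must agree
   with K0 below m, have labels at least b, and make the machine e output 1. *)
Definition valid_event (O ev : nat -> bool) (t : nat) : bool :=
  Nat.odd t && Nat.odd (target t) && negb (ev (target t)) && mem ev (target t) t &&
  good_set O ev (kept t) t (snd_of (snd_of (rank ev (target t)))) &&
  ball (fst_of (snd_of (rank ev (target t)))) (fun k =>
    Bool.eqb (Nat.testbit (kept t) k)
             (Nat.testbit (snd_of (fst_of (rank ev (target t)))) k)) &&
  (run (finite_oracle O (kept t)) (steps t)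
     (enter (fst_of (fst_of (rank ev (target t)))) (stage_code O (target t)) 0)
   =? ret 1 0).

(** Course-of-values recursion: [r] tabulates the decisions below [t]. *)
Definition events (O : nat -> bool) (t : nat) : nat :=
  primrec 0 (fun t r => pair r (Nat.b2n (valid_event O (fun k => lookup t r k =? 1) t))) t.

Definition event (O : nat -> bool) (t : nat) : bool := lookup (S t) (events O (S t)) t =? 1.

Definition survives (O : nat -> bool) (n : nat) : Prop :=
  forall t, n < t -> kills (event O) t n = false.

Lemma target_lt t : Nat.odd t = true -> target t < t.
Proof.
  intros H. unfold target. pose proof (fst_of_le (Nat.div2 t)).
  pose proof (Nat.div2_odd t). rewrite H in *. simpl in *. lia.
Qed.

Lemma testbit_lt K k : Nat.testbit K k = true -> k < K.
Proof.
  intros H. destruct (Nat.lt_ge_cases k K) as [|Hle]; [easy|].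
  rewrite Nat.testbit_eqb, Nat.div_small in H; [easy|].
  apply Nat.le_lt_trans with k; [easy|]. apply Nat.pow_gt_lin_r. lia.
Qed.

Lemma kept_lt t k : Nat.testbit (kept t) k = true -> k < t.
Proof.
  intros H%testbit_lt. unfold kept in H.
  pose proof (fst_of_le (snd_of (Nat.div2 t))). pose proof (snd_of_le (Nat.div2 t)).
  pose proof (Nat.div2_odd t). lia.
Qed.

(** * Dependence of validity on earlier events only *)

Section Agreement.

Variables (O ev ev' : nat -> bool).

Lemma mem_agree n t : (forall k, k < t -> ev k = ev' k) -> mem ev n t = mem ev' n t.
Proof.
  intros H. apply ball_ext. intros s Hs. unfold kills. now rewrite H.
Qed.

Lemma rank_agree t : (forall k, k < t -> ev k = ev' k) -> rank ev t = rank ev' t.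
Proof.
  intros H. apply count_ext. intros k Hk. now rewrite (mem_agree k t H).
Qed.

(** Since [target t < t] for odd [t], all that is consulted concerns events below [t]; this licenses
    the recursion through a table. *)
Lemma valid_event_agree t :
  (forall k, k < t -> ev k = ev' k) -> valid_event O ev t = valid_event O ev' t.
Proof.
  intros H. unfold valid_event. destruct (Nat.odd t) eqn:Ht; [|easy].
  pose proof (target_lt t Ht) as Hx.
  assert (Hl : forall s, s <= t -> rank ev s = rank ev' s).
  { intros s Hs. apply rank_agree. intros k Hk. apply H. lia. }
  rewrite (H (target t)), (Hl (target t)), (mem_agree _ t) by (easy || lia).
  do 2 f_equal. f_equal.
  apply ball_ext. intros k Hk. unfold label.
  rewrite (mem_agree k t H), (Hl k) by lia. do 2 f_equal.
  apply ball_ext. intros j Hj. now rewrite (Hl j) by lia.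
Qed.

End Agreement.

(** * Computability of the event predicate *)

Section Effectiveness.

Context {I : Type} (X : I -> nat -> bool) (O : I -> nat -> bool).
Hypothesis HO : decidable X O.

Ltac comp_hook ::=
  lazymatch goal with
  | |- decidable _ (fun i n => O i (@?F i n)) => apply (decidable_comp X O F HO)
  end.

Lemma decidable_setlt F G :
  computable X F -> computable X G -> decidable X (fun i n => setlt (O i) (F i n) (G i n)).
Proof.
  intros HF HG.
  assert (H : decidable X (fun i n => setlt (O i) (fst_of n) (snd_of n)))
    by (unfold setlt; comp).
  eapply computable_ext; [|apply (computable_comp X _ (fun i n => pair (F i n) (G i n)) H)].
  - intros i n. cbv beta. now rewrite fst_pair, snd_pair.
  - now apply computable_pair.
Qed.

Lemma computable_stage_code F :
  computable X F -> computable X (fun i n => stage_code (O i) (F i n)).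
Proof.
  intros HF. apply computable_pair; [easy|].
  apply computable_ext with
    (fun i n => primrec 0 (fun t r => pair r (Nat.b2n (O i t))) (F i n)).
  - intros i n. induction (F i n) as [|t IH]; [easy|]. now rewrite primrec_S, IH.
  - apply computable_primrec; comp. exact HF.
Qed.

Ltac comp_hook ::=
  lazymatch goal with
  | |- decidable _ (fun i n => O i (@?F i n)) => apply (decidable_comp X O F HO)
  | |- decidable _ (fun i n => setlt (O i) (@?F i n) (@?G i n)) => apply (decidable_setlt F G)
  | |- computable _ (fun i n => stage_code (O i) (@?F i n)) => apply (computable_stage_code F)
  end.

Lemma decidable_event : decidable X (fun i t => event (O i) t).
Proof.
  unfold event, events, valid_event, good_set, setle, run, label, rank, mem, kills,
    target, kept, steps, finite_oracle, step, step_enter, step_ret, query, enter, ret, push.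
  comp.
Qed.
End Effectiveness.

(** * Survival, ranks and requirements *)

Section Construction.

Variable O : nat -> bool.
Notation ev := (event O).
Notation alive := (survives O).

Lemma lookup_events t k : k < t -> (lookup t (events O t) k =? 1) = ev k.
Proof.
  induction t as [|t IH]; [lia|]. intros Hk.
  destruct (Nat.eq_dec k t) as [->|]; [easy|].
  unfold events. rewrite primrec_S. rewrite lookup_S by lia. apply IH. lia.
Qed.

Lemma event_eq t : ev t = valid_event O ev t.
Proof.
  unfold event at 1, events. rewrite primrec_S, lookup_last.
  rewrite (valid_event_agree O _ ev) by apply lookup_events.
  now destruct (valid_event O ev t).
Qed.

Lemma kills_true t n :
  kills ev t n = true <-> ev t = true /\ target t <= n /\ Nat.testbit (kept t) n = false.
Proof.
  unfold kills. rewrite !andb_true_iff, Nat.leb_le, negb_true_iff. tauto.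
Qed.

Lemma mem_true n t :
  mem ev n t = true <-> forall s, n < s < t -> kills ev s n = false.
Proof.
  unfold mem. rewrite ball_true. split; intros H s Hs.
  - specialize (H s). rewrite orb_true_iff, Nat.leb_le, negb_true_iff in H.
    destruct H; lia || easy.
  - rewrite orb_true_iff, Nat.leb_le, negb_true_iff.
    destruct (Nat.le_gt_cases s n); [now left|right; apply H; lia].
Qed.

Lemma alive_mem n t : alive n -> mem ev n t = true.
Proof. intros H. apply mem_true. intros s Hs. apply H. lia. Qed.

Record event_facts (t : nat) : Prop := {
  event_odd : Nat.odd t = true;
  event_target_odd : Nat.odd (target t) = true;
  event_target : ev (target t) = false;
  event_target_mem : mem ev (target t) t = true;
  event_good : good_set O ev (kept t) t (snd_of (snd_of (rank ev (target t)))) = true;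
  event_agree : forall k, k < fst_of (snd_of (rank ev (target t))) ->
    Nat.testbit (kept t) k = Nat.testbit (snd_of (fst_of (rank ev (target t)))) k;
  event_run : run (finite_oracle O (kept t)) (steps t)
     (enter (fst_of (fst_of (rank ev (target t)))) (stage_code O (target t)) 0) = ret 1 0 }.

Lemma event_iff t : ev t = true <-> event_facts t.
Proof.
  rewrite event_eq. unfold valid_event.
  rewrite !andb_true_iff, negb_true_iff, Nat.eqb_eq, ball_true. split.
  - intros [[[[[[H1 H2] H3] H4] H5] H6] H7]. split; try easy.
    intros k Hk. now apply eqb_prop, H6.
  - intros [H1 H2 H3 H4 H5 H6 H7]. repeat split; try easy.
    intros k Hk. apply eqb_true_iff. now apply H6.
Qed.

Record good_facts (K t b : nat) : Prop := {
  good_even : forall k, Nat.testbit K k = true -> Nat.odd k = false;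
  good_mem : forall k, Nat.testbit K k = true -> mem ev k t = true;
  good_le : forall k, Nat.testbit K k = true -> setle O b (label ev k) = true;
  good_descending : forall j k, j < k -> Nat.testbit K j = true -> Nat.testbit K k = true ->
    setlt O (label ev k) (label ev j) = true }.

Lemma good_set_iff K t b :
  (forall k, Nat.testbit K k = true -> k < t) ->
  good_set O ev K t b = true <-> good_facts K t b.
Proof.
  intros HK. unfold good_set. rewrite ball_true.
  assert (E : forall k, negb (Nat.testbit K k) ||
    negb (Nat.odd k) && mem ev k t && setle O b (label ev k) &&
    ball k (fun j => negb (Nat.testbit K j) || setlt O (label ev k) (label ev j)) = true <->
    (Nat.testbit K k = true -> Nat.odd k = false /\ mem ev k t = true /\
      setle O b (label ev k) = true /\ forall j, j < k -> Nat.testbit K j = true ->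
      setlt O (label ev k) (label ev j) = true)).
  { intros k. destruct (Nat.testbit K k); simpl; [|easy].
    rewrite !andb_true_iff, negb_true_iff, ball_true. split.
    - intros [[[H1 H2] H3] H4] _. repeat split; try easy. intros j Hj HKj.
      specialize (H4 j Hj). now rewrite HKj in H4.
    - intros H. destruct (H eq_refl) as (H1 & H2 & H3 & H4). repeat split; try easy.
      intros j Hj. destruct (Nat.testbit K j) eqn:HKj; [|easy]. now apply H4. }
  split.
  - intros H.
    assert (H' : forall k, Nat.testbit K k = true -> Nat.odd k = false /\ mem ev k t = true /\
      setle O b (label ev k) = true /\ forall j, j < k -> Nat.testbit K j = true ->
      setlt O (label ev k) (label ev j) = true).
    { intros k Hk. apply (E k); [|easy]. apply H, HK, Hk. }
    split; intros; now apply H'.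
  - intros [H1 H2 H3 H4] k Hk. apply E. intros Hb. repeat split; auto.
Qed.

Lemma event_good_facts t :
  ev t = true -> good_facts (kept t) t (snd_of (snd_of (rank ev (target t)))).
Proof.
  intros H%event_iff. apply good_set_iff; [apply kept_lt|apply (event_good _ H)].
Qed.

Lemma kept_even t k : ev t = true -> Nat.odd k = true -> Nat.testbit (kept t) k = false.
Proof.
  intros Ht Hk. destruct (Nat.testbit (kept t) k) eqn:E; [|easy].
  now rewrite (good_even _ _ _ (event_good_facts t Ht) k E) in Hk.
Qed.

(* Only even numbers are kept, so whatever kills n kills every odd number from n on. *)
Lemma kills_odd t n x : n <= x -> Nat.odd x = true -> kills ev t n = true -> kills ev t x = true.
Proof.
  rewrite !kills_true. intros Hnx Hx (Ht & Hle & _).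
  repeat split; [easy|lia|now apply kept_even].
Qed.

(** True stages in the sense of computability theory: the approximation below [N] is already
    correct. *)
Definition true_stage (N : nat) : Prop := forall k, k < N -> mem ev k N = true -> alive k.

(** An event after [x] that removes some [k <= x] would remove the odd number [x] as well. *)
Lemma alive_true_stage x : Nat.odd x = true -> alive x -> true_stage (S x).
Proof.
  intros Hx Ha k Hk Hm t Ht. destruct (Nat.le_gt_cases t x) as [Hle|Hgt].
  - rewrite mem_true in Hm. apply Hm. lia.
  - destruct (kills ev t k) eqn:E; [|easy].
    apply (kills_odd t k x) in E; [|lia|easy]. now rewrite Ha in E by lia.
Qed.

Lemma not_alive n : ~ alive n -> exists t, n < t /\ kills ev t n = true.
Proof.
  intros H. apply NNPP. intros N. apply H. intros t Ht.
  destruct (kills ev t n) eqn:E; [|easy]. exfalso. apply N. now exists t.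
Qed.

Lemma least (P : nat -> Prop) : (exists n, P n) -> exists n, P n /\ forall m, m < n -> ~ P m.
Proof.
  intros [n Hn]. revert Hn. induction n as [n IH] using lt_wf_ind. intros Hn.
  destruct (classic (exists m, m < n /\ P m)) as [[m [Hm HP]]|N].
  - now apply IH with m.
  - exists n. split; [easy|]. intros m Hm HP. apply N. now exists m.
Qed.

Lemma bounded_settling N :
  exists M, forall n, n < N -> ~ alive n -> exists t, n < t < M /\ kills ev t n = true.
Proof.
  induction N as [|N [M HM]]; [exists 0; lia|].
  destruct (classic (alive N)) as [Ha|Hd].
  - exists M. intros n Hn Hd. apply HM; [|easy].
    destruct (Nat.eq_dec n N) as [->|]; [easy|lia].
  - destruct (not_alive N Hd) as [t [Ht Hk]]. exists (M + S t). intros n Hn Hdn.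
    destruct (Nat.eq_dec n N) as [->|].
    + exists t. split; [lia|easy].
    + destruct (HM n) as [s [Hs Hks]]; [lia|easy|]. exists s. split; [lia|easy].
Qed.

(* Among the events after a late stage, the one with the least target survives. *)
Lemma odd_alive_unbounded N : exists x, N <= x /\ Nat.odd x = true /\ alive x.
Proof.
  apply NNPP. intros Hno.
  assert (Hdead : forall x, N <= x -> Nat.odd x = true -> ~ alive x).
  { intros x H1 H2 H3. apply Hno. now exists x. }
  destruct (bounded_settling N) as [M HM].
  destruct (least (fun y => exists t, N + M < t /\ ev t = true /\ target t = y))
    as [y [(t & Ht & Hev & Hy) Hmin]].
  { destruct (not_alive (2 * (N + M) + 1)) as [t [Ht Hk]].
    - apply Hdead; [lia|]. apply Nat.odd_spec. now exists (N + M).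
    - apply kills_true in Hk. exists (target t), t. repeat split; [lia|easy]. }
  pose proof (proj1 (event_iff t) Hev) as F.
  destruct (not_alive t) as [s [Hs Hk]]; [apply Hdead; [lia|apply (event_odd _ F)]|].
  apply kills_true in Hk. destruct Hk as (Hevs & Hle & Hkept).
  pose proof (proj1 (event_iff s) Hevs) as G.
  (* A target is not itself an event, so the target of [s] is strictly below [t]. *)
  destruct (Nat.eq_dec (target s) t) as [E|].
  { pose proof (event_target _ G). congruence. }
  pose proof (event_target_mem _ G) as Hm. rewrite mem_true in Hm.
  specialize (Hm t ltac:(lia)).
  (* The target of [s] was still present at [s], so [t] did not kill it and it lies below [y],
     against minimality. *)
  apply (Hmin (target s)); [|now exists s; repeat split; [lia|]].
  destruct (Nat.lt_ge_cases (target s) y) as [|Hge]; [easy|].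
  assert (kills ev t (target s) = true); [|congruence].
  apply kills_true. repeat split; [easy|lia|].
  apply kept_even; [easy|apply (event_target_odd _ G)].
Qed.

(** [S x] is a true stage too, so both counts are of genuine survivors, and [x] is the only new
    one. *)
Lemma rank_succ N x :
  true_stage N -> N <= x -> Nat.odd x = true -> alive x ->
  (forall k, N <= k < x -> Nat.odd k = true -> ~ alive k) ->
  rank ev (S x) = S (rank ev N).
Proof.
  intros HN Hle Hx Ha Hdead. unfold rank at 1. rewrite count_S, Hx, alive_mem by easy.
  rewrite (count_false _ N x).
  - cbn [andb Nat.b2n]. rewrite Nat.add_1_r. f_equal. apply count_ext. intros k Hk. f_equal.
    apply eq_iff_eq_true. split; intros H.
    + rewrite mem_true in *. intros s Hs. apply H. lia.
    + apply alive_mem, HN; easy.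
  - easy.
  - intros k Hk. destruct (Nat.odd k) eqn:Ho; [|easy]. cbn [andb Nat.b2n].
    destruct (mem ev k (S x)) eqn:Hm; [|easy].
    exfalso. apply (Hdead k Hk Ho). apply (alive_true_stage x Hx Ha); [lia|easy].
Qed.

(** From a true stage, the next odd survivor raises the rank by exactly one and yields a true stage
    again; hence no requirement is skipped. *)
Lemma odd_alive_of_rank p :
  exists x, Nat.odd x = true /\ alive x /\ rank ev (S x) = S p.
Proof.
  assert (Hnext : forall N, true_stage N -> exists x, Nat.odd x = true /\ alive x /\
            rank ev (S x) = S (rank ev N)).
  { intros N HN.
    destruct (least (fun x => N <= x /\ Nat.odd x = true /\ alive x)) as [x [(H1 & H2 & H3) Hmin]].
    { apply odd_alive_unbounded. }
    exists x. repeat split; try easy. apply rank_succ; try easy.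
    intros k Hk Ho Ha. apply (Hmin k); [lia|]. repeat split; easy || lia. }
  induction p as [|p [x (Hx & Ha & Hr)]].
  - apply (Hnext 0). intros k Hk. lia.
  - rewrite <- Hr. apply Hnext, alive_true_stage; easy.
Qed.

Lemma rank_le t : rank ev t <= t.
Proof. apply count_le. Qed.

(** Take the even stage after an odd survivor [x]. Targets are odd and kept numbers even, so an
    event killing [S x] would kill [x]. Coding [N] into the rank, which never exceeds the stage,
    makes the stage large. *)
Lemma label_unbounded w N :
  exists n, N <= n /\ Nat.odd n = false /\ alive n /\ label ev n = w.
Proof.
  (* The ranks supplied are successors; the component [S N] makes the pair positive. *)
  destruct (odd_alive_of_rank (Nat.pred (pair w (S N)))) as [x (Hx & Ha & Hr)].
  pose proof (pair_ge w (S N)).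
  replace (S (Nat.pred (pair w (S N)))) with (pair w (S N)) in Hr by lia.
  pose proof (rank_le (S x)). exists (S x). repeat split.
  - lia.
  - rewrite Nat.odd_succ, <- Nat.negb_odd, Hx. easy.
  - intros t Ht. destruct (kills ev t (S x)) eqn:E; [|easy].
    apply kills_true in E. destruct E as (Hev & Hle & Hk).
    pose proof (event_target_odd _ (proj1 (event_iff t) Hev)) as Ho.
    assert (target t <> S x).
    { intros Heq. rewrite Heq, Nat.odd_succ, <- Nat.negb_odd, Hx in Ho. easy. }
    assert (kills ev t x = true).
    { apply kills_true. repeat split; [easy|lia|]. now apply kept_even. }
    now rewrite Ha in * by lia.
  - unfold label. now rewrite Hr, fst_pair.
Qed.

Lemma rank_non_event x :
  Nat.odd x = true -> ev x = false -> rank ev (S x) = S (rank ev x).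
Proof.
  intros Hx He. unfold rank. rewrite count_S, Hx. cbn [andb Nat.b2n].
  replace (mem ev x (S x)) with true.
  - cbn [andb Nat.b2n]. rewrite Nat.add_1_r. f_equal. apply count_ext. intros k Hk. f_equal.
    apply eq_iff_eq_true. rewrite !mem_true. split; intros H s Hs; [apply H; lia|].
    destruct (Nat.eq_dec s x) as [->|]; [|apply H; lia].
    unfold kills. now rewrite He.
  - symmetry. apply mem_true. lia.
Qed.

(** An event takes the place of its target: it kills the odd numbers from the target up to itself
    and is counted in their stead. No event strictly between the two can have killed a smaller odd
    number, as it would have killed the target. *)
Lemma rank_event t : ev t = true -> rank ev (S t) = S (rank ev (target t)).
Proof.
  intros He. pose proof (proj1 (event_iff t) He) as F.
  pose proof (target_lt t (event_odd _ F)) as Hlt.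
  unfold rank at 1. rewrite count_S, (event_odd _ F).
  rewrite (count_false _ (target t) t).
  - replace (mem ev t (S t)) with true by (symmetry; apply mem_true; lia).
    cbn [andb Nat.b2n]. rewrite Nat.add_1_r. f_equal. apply count_ext. intros k Hk. f_equal.
    apply eq_iff_eq_true. rewrite !mem_true. split; intros H s Hs; [apply H; lia|].
    destruct (kills ev s k) eqn:E; [|easy].
    destruct (Nat.lt_ge_cases s (target t)) as [Hs1|Hs1]; [now rewrite H in E by lia|].
    destruct (Nat.eq_dec s (target t)) as [->|].
    + apply kills_true in E. destruct E as [E _]. now rewrite (event_target _ F) in E.
    + destruct (Nat.eq_dec s t) as [->|].
      * apply kills_true in E. lia.
      * apply (kills_odd s k (target t)) in E; [|lia|apply (event_target_odd _ F)].
        pose proof (event_target_mem _ F) as Hm. rewrite mem_true in Hm.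
        now rewrite Hm in E by lia.
  - lia.
  - intros k Hk. destruct (Nat.odd k) eqn:Ho; [|easy]. cbn [andb Nat.b2n].
    destruct (mem ev k (S t)) eqn:Hm; [|easy]. rewrite mem_true in Hm.
    assert (kills ev t k = true).
    { apply kills_true. repeat split; [easy|lia|now apply kept_even]. }
    now rewrite Hm in * by lia.
Qed.

(* At stage 0 membership is vacuous, so [good_facts] only constrains parity and labels. *)
Definition finite_good (K b : nat) : Prop :=
  good_facts K 0 b /\ forall k, Nat.testbit K k = true -> alive k.

(* The requirement e with condition (K0, m, b) is met at the surviving odd number of the
   corresponding rank: either its machine e never acts on it, or an event records a
   computation with the wrong answer. *)
Lemma requirement e K0 m b :
  (exists x, alive x /\ forall K n, finite_good K b ->
     (forall k, k < m -> Nat.testbit K k = Nat.testbit K0 k) ->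
     run (finite_oracle O K) n (enter e (stage_code O x) 0) <> ret 1 0)
  \/
  (exists x K n, ~ alive x /\ finite_good K b /\
     (forall k, k < m -> Nat.testbit K k = Nat.testbit K0 k) /\
     run (finite_oracle O K) n (enter e (stage_code O x) 0) = ret 1 0).
Proof.
  destruct (odd_alive_of_rank (pair (pair e K0) (pair m b))) as [t (Hx & Ha & Hr)].
  destruct (ev t) eqn:He.
  - right. rewrite (rank_event t He) in Hr. injection Hr as Hr.
    pose proof (proj1 (event_iff t) He) as F. pose proof (event_good_facts t He) as G.
    destruct F as [F1 F2 F3 F4 F5 F6 F7]. rewrite Hr in *.
    rewrite !fst_pair, ?snd_pair, ?fst_pair, ?snd_pair in *.
    pose proof (target_lt t F1) as Hlt.
    exists (target t), (kept t), (steps t). repeat split; try easy.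
    + intros H. specialize (H t Hlt).
      assert (kills ev t (target t) = true); [|congruence].
      apply kills_true. repeat split; [easy|lia|now apply kept_even].
    + apply (good_even _ _ _ G).
    + apply (good_le _ _ _ G).
    + apply (good_descending _ _ _ G).
    + intros k Hk. pose proof (kept_lt t k Hk) as Hkt.
      (* As [t] survives, [S t] is a true stage, so the kept elements, still present after [t],
         survive too. *)
      apply (alive_true_stage t Hx Ha); [lia|].
      pose proof (good_mem _ _ _ G k Hk) as Hm. rewrite mem_true in *. intros s Hs.
      destruct (Nat.eq_dec s t) as [->|]; [|apply Hm; lia].
      unfold kills. now rewrite Hk, andb_false_r.
  - left. exists t. split; [easy|]. intros K n [G HK] Hagree Hrun.
    rewrite (rank_non_event t Hx He) in Hr. injection Hr as Hr.
    (* The number coding this computation would be a valid event with target [t], killing the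
       survivor [t]. *)
    set (s := S (2 * pair t (pair K n))).
    assert (Ho : Nat.odd s = true).
    { apply Nat.odd_spec. exists (pair t (pair K n)). unfold s. lia. }
    assert (Hd : Nat.div2 s = pair t (pair K n)) by apply Nat.div2_succ_double.
    assert (Ht : target s = t) by (unfold target; now rewrite Hd, fst_pair).
    assert (Hk : kept s = K) by (unfold kept; now rewrite Hd, snd_pair, fst_pair).
    assert (Hn : steps s = n) by (unfold steps; now rewrite Hd, !snd_pair).
    assert (Hlt : t < s) by (pose proof (target_lt s Ho); congruence).
    assert (Hev : ev s = true).
    { apply event_iff. split; rewrite ?Ht, ?Hk, ?Hn, ?Hr; try easy.
      - now apply alive_mem.
      - rewrite snd_pair, snd_pair. apply good_set_iff.
        + intros k Hb. apply kept_lt. now rewrite Hk.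
        + destruct G as [G1 G2 G3 G4]. split; auto. intros k Hb. now apply alive_mem, HK.
      - now rewrite snd_pair, fst_pair, fst_pair, snd_pair.
      - now rewrite !fst_pair. }
    assert (kills ev s t = true); [|now rewrite Ha in *].
    apply kills_true. repeat split; [easy|lia|now apply kept_even].
Qed.

(* For a surviving pair s < s' whose labels do not decrease, no event after s' can keep
   both of them, hence none has its target at or below s. *)
Lemma survives_from_pair m s s' :
  m <= s -> s < s' -> alive s -> alive s' ->
  setlt O (label ev s') (label ev s) = false ->
  (alive m <-> mem ev m (S s') = true).
Proof.
  intros Hm Hs Ha Ha' Hlab. split; [now intros; apply alive_mem|].
  rewrite mem_true. intros Hmem t Ht.
  destruct (Nat.le_gt_cases t s') as [Hle|Hgt]; [apply Hmem; lia|].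
  destruct (kills ev t m) eqn:E; [|easy].
  apply kills_true in E. destruct E as (He & Hle & Hk).
  pose proof (event_good_facts t He) as G.
  assert (Hkeep : forall k, s <= k -> k < t -> alive k -> Nat.testbit (kept t) k = true).
  { intros k H1 H2 H3. destruct (Nat.testbit (kept t) k) eqn:E; [easy|].
    assert (kills ev t k = true); [|now rewrite H3 in *].
    apply kills_true. repeat split; easy || lia. }
  rewrite (good_descending _ _ _ G s s') in Hlab; try easy; apply Hkeep; easy || lia.
Qed.

End Construction.

(** * Unbounded search and enumeration of the complement *)

Lemma computable_search {I : Type} (X : I -> nat -> bool) (B : I -> nat -> bool) :
  decidable X B -> (forall i n, exists m, B i (pair n m) = true) ->
  exists G, computable X G /\ forall i n, B i (pair n (G i n)) = true.
Proof.
  intros HB Hex.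
  assert (Hleast : forall i n, exists m,
            B i (pair n m) = true /\ forall k, k < m -> B i (pair n k) <> true)
    by (intros; apply least, Hex).
  exists (fun i n => proj1_sig (constructive_indefinite_description _ (Hleast i n))).
  split.
  - apply computable_mu with B; [easy|]. intros i n.
    destruct (constructive_indefinite_description _ (Hleast i n)) as [m [Hm Hmin]]. simpl.
    split; [easy|]. intros k Hk. now apply not_true_is_false, Hmin.
  - intros i n.
    now destruct (constructive_indefinite_description _ (Hleast i n)) as [m [Hm Hmin]].
Qed.

(** Wait for an event that kills the stage of [n]; numbers that are not stage codes are enumerated
    at once. *)
Lemma complement_enumerable :
  exists e, forall O n,
    halts O e n <-> ~ (n = stage_code O (fst_of n) /\ survives O (fst_of n)).
Proof.
  set (X := fun O : nat -> bool => O).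
  assert (HO : decidable X X) by apply decidable_oracle.
  pose proof (decidable_event X X HO) as Hev.
  (* The outer negation is there because [CMu] looks for the value 0. *)
  assert (Hdec : decidable X (fun O p =>
    negb (negb (fst_of p =? stage_code (X O) (fst_of (fst_of p))) ||
    (fst_of (fst_of p) <? snd_of p) &&
      kills (event (X O)) (snd_of p) (fst_of (fst_of p))))).
  { unfold kills, target, kept.
    repeat (comp; lazymatch goal with
      | |- decidable _ (fun O n => event (X O) (@?F O n)) => apply (decidable_comp X _ F Hev)
      | |- computable _ (fun O n => stage_code (X O) (@?F O n)) =>
          apply (computable_stage_code X X HO F)
      end). }
  destruct Hdec as [c Hc]. unfold X in Hc. exists (CMu c). intros O n.
  assert (Hcode : forall t, eval O c (pair n t)
    (Nat.b2n (negb (negb (n =? stage_code O (fst_of n)) ||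
      (fst_of n <? t) && kills (event O) t (fst_of n))))).
  { intros t. specialize (Hc O (pair n t)). now rewrite fst_pair, snd_pair in Hc. }
  split.
  - intros [t Ht] [E Hs]. inversion Ht as [| | | | | | | | | |f x m H0 Hlt]; subst.
    pose proof (eval_functional _ _ _ _ _ H0 (Hcode t)) as E'.
    rewrite (proj2 (Nat.eqb_eq _ _) E) in E'. simpl in E'.
    destruct (Nat.ltb_spec (fst_of n) t) as [Hl|]; simpl in E'; [|easy].
    now rewrite (Hs t Hl) in E'.
  - intros Hn.
    destruct (least (fun t => negb (n =? stage_code O (fst_of n)) ||
      (fst_of n <? t) && kills (event O) t (fst_of n) = true)) as [t [Ht Hmin]].
    + destruct (Nat.eqb_spec n (stage_code O (fst_of n))) as [E|]; [|now exists 0].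
      destruct (not_alive O (fst_of n)) as [t [Hlt Hk]]; [tauto|].
      exists t. now rewrite Hk, (proj2 (Nat.ltb_lt _ _) Hlt).
    + exists t. constructor.
      * specialize (Hcode t). now rewrite Ht in Hcode.
      * intros m Hm. exists 0. specialize (Hcode m).
        now rewrite (not_true_is_false _ (Hmin m Hm)) in Hcode.
Qed.

Lemma order_oracle_pair le a b : order_oracle le (pair a b) = le a b.
Proof. unfold order_oracle. now rewrite fst_pair, snd_pair. Qed.

(** * The ordering of labels *)

Section LabelOrder.

Variable le : nat -> nat -> bool.
Hypothesis Hle : is_linear_order le.

Lemma le_refl a : le a a = true.
Proof. apply Hle. Qed.

Lemma le_antisym a b : le a b = true -> le b a = true -> a = b.
Proof. apply Hle. Qed.

Lemma le_trans a b c : le a b = true -> le b c = true -> le a c = true.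
Proof. apply Hle. Qed.

Lemma le_total a b : le a b = true \/ le b a = true.
Proof. apply Hle. Qed.

Lemma le_strict_trans a b c : le a b = true -> strict le b c -> strict le a c.
Proof.
  intros H [H1 H2]. split; [now apply le_trans with b|].
  intros ->. apply H2. now apply le_antisym.
Qed.

Lemma max_exists (P : nat -> Prop) N :
  (exists c, c < N /\ P c) ->
  exists c, P c /\ forall c', c' < N -> P c' -> le c' c = true.
Proof.
  induction N as [|N IH]; intros [c [Hc HP]]; [lia|].
  destruct (classic (exists c, c < N /\ P c)) as [[c0 Hc0]|Hno].
  - destruct IH as [d [Hd Hmax]]; [now exists c0|].
    destruct (classic (P N)) as [HN|HN].
    + destruct (le_total N d) as [Hl|Hl].
      * exists d. split; [easy|]. intros c' H1 H2.
        destruct (Nat.eq_dec c' N) as [->|]; [easy|]. apply Hmax; [lia|easy].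
      * exists N. split; [easy|]. intros c' H1 H2.
        destruct (Nat.eq_dec c' N) as [->|]; [apply le_refl|].
        apply le_trans with d; [apply Hmax; [lia|easy]|easy].
    + exists d. split; [easy|]. intros c' H1 H2. apply Hmax; [|easy].
      destruct (Nat.eq_dec c' N) as [->|]; [easy|lia].
  - assert (c = N) as ->.
    { destruct (Nat.eq_dec c N); [easy|]. exfalso. apply Hno. exists c. split; [lia|easy]. }
    exists N. split; [easy|]. intros c' H1 H2.
    destruct (Nat.eq_dec c' N) as [->|]; [apply le_refl|].
    exfalso. apply Hno. exists c'. split; [lia|easy].
Qed.

(** [D] restricts where the deciding element may lie; taking initial segments of the ordering for
    [D] allows induction along it. *)
Definition lt_within (D : nat -> Prop) (u v : nat) : Prop :=
  exists a, D a /\ Nat.testbit v a = true /\ Nat.testbit u a = false /\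
    forall c, Nat.testbit u c = Nat.testbit v c \/ le c a = true.

Lemma setlt_iff u v :
  setlt (order_oracle le) u v = true <-> lt_within (fun _ => True) u v.
Proof.
  unfold setlt. rewrite bex_true. split.
  - intros [a [_ H]]. rewrite !andb_true_iff, negb_true_iff, ball_true in H.
    destruct H as [[H1 H2] H3]. exists a. repeat split; try easy. intros c.
    destruct (Nat.lt_ge_cases c (u + v)) as [Hc|Hc].
    + specialize (H3 c Hc). rewrite orb_true_iff, eqb_true_iff, order_oracle_pair in H3. easy.
    + left. transitivity false; [|symmetry]; apply not_true_is_false;
        intros E%testbit_lt; lia.
  - intros [a (_ & H1 & H2 & H3)]. exists a. split; [now apply testbit_lt|].
    rewrite !andb_true_iff, negb_true_iff, ball_true. repeat split; try easy.
    intros c _. rewrite orb_true_iff, eqb_true_iff, order_oracle_pair. apply H3.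
Qed.

(* Below the largest element c of u in D, a descent either keeps c and moves below c,
   or loses c and then all later changes in D are below c as well. *)
Lemma lt_within_wf_step D :
  (forall a, D a -> well_founded (lt_within (fun c => strict le c a))) ->
  well_founded (lt_within D).
Proof.
  intros HD.
  (* If all elements in [D] of the set lie below [c1], every descent is decided below [c1] and
     preserves this. *)
  assert (Hbelow : forall c1, D c1 -> forall v,
    Acc (lt_within (fun c => strict le c c1)) v ->
    (forall c, D c -> Nat.testbit v c = true -> strict le c c1) -> Acc (lt_within D) v).
  { intros c1 Hc1 v HA. induction HA as [v _ IH]. intros Hv.
    constructor. intros v' (c & HDc & H1 & H2 & H3).
    assert (Hc : strict le c c1) by now apply Hv.
    apply IH; [now exists c|]. intros c' HDc' Hb.
    destruct (H3 c') as [E|E]; [apply Hv; congruence|].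
    now apply le_strict_trans with c. }
  intros u. destruct (classic (exists c, c < u /\ D c /\ Nat.testbit u c = true)) as [Hex|Hno].
  - destruct (max_exists _ u Hex) as [c1 [[HD1 Hb1] Hmax]].
    assert (Hu : forall c, D c -> Nat.testbit u c = true -> le c c1 = true).
    { intros c H1 H2. apply Hmax; [now apply testbit_lt|easy]. }
    clear Hex Hmax. revert Hb1 Hu. pose proof (HD c1 HD1 u) as HA.
    induction HA as [u _ IH]. intros Hb1 Hu.
    constructor. intros v (c & HDc & H1 & H2 & H3).
    (* Losing [c1] leaves only elements of [D] below it; otherwise [c1] is still the largest element
       in [D]. *)
    destruct (Nat.eq_dec c c1) as [->|Hne].
    + apply (Hbelow c1 HD1); [now apply HD|]. intros c' HDc' Hb. split; [|congruence].
      destruct (H3 c') as [E|E]; [apply Hu; congruence|easy].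
    + assert (Hc : strict le c c1) by (split; [now apply Hu|easy]).
      apply IH.
      * now exists c.
      * destruct (H3 c1) as [E|E]; [congruence|].
        exfalso. apply Hne. apply le_antisym; [now apply Hu|easy].
      * intros c' HDc' Hb. destruct (H3 c') as [E|E]; [apply Hu; congruence|].
        apply le_trans with c; [easy|now apply Hu].
  - constructor. intros v (c & HDc & H1 & _). exfalso. apply Hno.
    exists c. split; [now apply testbit_lt|easy].
Qed.

(** Induction on [a] gives the case where [D] is the initial segment below [a]; one further step
    removes the restriction. *)
Lemma setlt_wf :
  well_founded (strict le) -> well_founded (fun u v => setlt (order_oracle le) u v = true).
Proof.
  intros Hwf. apply wf_incl with (lt_within (fun _ => True)).
  - intros u v. apply setlt_iff.
  - apply lt_within_wf_step. intros a _. induction (Hwf a) as [a _ IH].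
    apply lt_within_wf_step. exact IH.
Qed.

(** The larger of the two deciding elements decides the composite. *)
Lemma setlt_trans u v w :
  setlt (order_oracle le) u v = true -> setlt (order_oracle le) v w = true ->
  setlt (order_oracle le) u w = true.
Proof.
  rewrite !setlt_iff. intros (a & _ & A1 & A2 & A3) (b & _ & B1 & B2 & B3).
  destruct (le_total a b) as [Hab|Hba].
  - exists b. repeat split; [easy| |].
    + destruct (A3 b) as [E|E]; [congruence|].
      assert (a = b) by now apply le_antisym. congruence.
    + intros c. destruct (A3 c), (B3 c); try (now right); [left; congruence|].
      right. now apply le_trans with a.
  - exists a. repeat split.
    + destruct (B3 a) as [E|E]; [congruence|].
      assert (a = b) by now apply le_antisym. congruence.
    + easy.
    + intros c. destruct (A3 c), (B3 c); try (now right); [left; congruence|].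
      right. now apply le_trans with b.
Qed.

End LabelOrder.

(** * Well-founded orderings *)

Section WellFounded.

Variable le : nat -> nat -> bool.
Hypothesis Hle : is_linear_order le.
Hypothesis Hwf : well_founded (strict le).
Notation O := (order_oracle le).

Variable A : nat -> Prop.
Hypothesis HA : forall n, A n <-> n = stage_code O (fst_of n) /\ survives O (fst_of n).

(** Bundled as an index type, so that [computable subset_oracle] means computability by a single
    functional from all infinite subsets. *)
Definition infinite_subset : Type :=
  {S : nat -> bool | subset_of S A /\ infinite_b S}.

Definition subset_oracle (i : infinite_subset) : nat -> bool := proj1_sig i.

Lemma subset_element i x :
  subset_oracle i x = true -> x = stage_code O (fst_of x) /\ survives O (fst_of x).
Proof. destruct i as [S [Hsub Hinf]]. intros Hx. apply HA. now apply Hsub. Qed.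

(** Elements of [A] are determined by their stages, so only finitely many have stage at most [m]. *)
Lemma subset_unbounded i m : exists x, subset_oracle i x = true /\ m < fst_of x.
Proof.
  pose proof (subset_element i) as Hel. destruct i as [T [Hsub Hinf]].
  simpl in *. unfold subset_oracle in *. simpl in *.
  assert (Hbound : exists b, forall k, k <= m -> stage_code O k < b).
  { induction m as [|m [b Hb]].
    - exists (S (stage_code O 0)). intros k Hk. replace k with 0; lia.
    - exists (S (b + stage_code O (S m))). intros k Hk.
      destruct (Nat.eq_dec k (S m)) as [->|]; [lia|].
      specialize (Hb k ltac:(lia)). lia. }
  destruct Hbound as [b Hb]. destruct (Hinf b) as [x [Hx HT]]. exists x. split; [easy|].
  destruct (Hel x HT) as [E _].
  destruct (Nat.lt_ge_cases m (fst_of x)) as [|Hge]; [easy|].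
  specialize (Hb _ Hge). rewrite <- E in Hb. lia.
Qed.

(** The history in any element with stage beyond [n] contains the value of the ordering at [n]. *)
Lemma subset_computes_order : decidable subset_oracle (fun _ => O).
Proof.
  destruct (computable_search subset_oracle
    (fun i p => subset_oracle i (snd_of p) && (fst_of p <? fst_of (snd_of p))))
    as [G [HG HB]].
  - comp. apply (decidable_comp _ _ (fun _ n => snd_of n) (decidable_oracle subset_oracle)).
    comp.
  - intros i n. destruct (subset_unbounded i n) as [x [Hx Hn]]. exists x.
    now rewrite fst_pair, snd_pair, Hx, (proj2 (Nat.ltb_lt _ _) Hn).
  - apply computable_ext with (fun i n => lookup (fst_of (G i n)) (snd_of (G i n)) n).
    + intros i n. specialize (HB i n).
      rewrite fst_pair, snd_pair, andb_true_iff, Nat.ltb_lt in HB. destruct HB as [H1 H2].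
      destruct (subset_element i _ H1) as [E _].
      apply (f_equal snd_of) in E. unfold stage_code in E. rewrite snd_pair in E.
      now rewrite E, lookup_history.
    + comp; exact HG.
Qed.

(** Moving to a later element either yields such a pair or lowers the label, which cannot go on
    forever. *)
Lemma nondecreasing_pair i n :
  exists x y, subset_oracle i x = true /\ subset_oracle i y = true /\
    fst_of x < fst_of y /\ n <= fst_of x /\
    setlt O (label (event O) (fst_of y)) (label (event O) (fst_of x)) = false.
Proof.
  destruct (subset_unbounded i n) as [x [Hx Hn]].
  remember (label (event O) (fst_of x)) as w eqn:Hw. revert x Hx Hn Hw.
  induction (setlt_wf le Hle Hwf w) as [w _ IH]. intros x Hx Hn ->.
  destruct (subset_unbounded i (fst_of x)) as [y [Hy Hxy]].
  destruct (setlt O (label (event O) (fst_of y)) (label (event O) (fst_of x))) eqn:E.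
  - apply (IH _ E y); [easy|lia|easy].
  - exists x, y. repeat split; easy || lia.
Qed.

(** Search the subset for two elements, at or beyond the stage of [n], whose labels do not decrease;
    membership of [n] is settled just after the second. *)
Lemma wf_uniformly_introreducible : uniformly_introreducible A.
Proof.
  split.
  { intros m. destruct (odd_alive_unbounded O m) as [s (Hs & _ & Ha)].
    exists (stage_code O s). split.
    - pose proof (pair_ge s (history O s)). unfold stage_code. lia.
    - apply HA. now rewrite fst_stage_code. }
  pose proof subset_computes_order as HO.
  pose proof (decidable_event _ _ HO) as Hev.
  destruct (computable_search subset_oracle (fun i p =>
    subset_oracle i (fst_of (snd_of p)) && subset_oracle i (snd_of (snd_of p)) &&
    (fst_of (fst_of (snd_of p)) <? fst_of (snd_of (snd_of p))) &&
    (fst_of (fst_of p) <=? fst_of (fst_of (snd_of p))) &&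
    negb (setlt O (label (event O) (fst_of (snd_of (snd_of p))))
                  (label (event O) (fst_of (fst_of (snd_of p)))))))
    as [G [HG HB]].
  - unfold label, rank, mem, kills, target, kept.
    repeat (comp; try lazymatch goal with
      | |- decidable _ (fun i n => subset_oracle i (@?F i n)) =>
          apply (decidable_comp _ _ F (decidable_oracle subset_oracle))
      | |- decidable _ (fun i n => event O (@?F i n)) => apply (decidable_comp _ _ F Hev)
      | |- decidable _ (fun i n => setlt O (@?F i n) (@?G i n)) =>
          apply (decidable_setlt _ _ HO F G)
      end).
  - intros i n. destruct (nondecreasing_pair i (fst_of n)) as (x & y & H1 & H2 & H3 & H4 & H5).
    exists (pair x y). rewrite fst_pair, snd_pair, !fst_pair, !snd_pair.
    now rewrite H1, H2, H5, (proj2 (Nat.ltb_lt _ _) H3), (proj2 (Nat.leb_le _ _) H4).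
  - assert (Hdec : decidable subset_oracle (fun i n =>
      (n =? stage_code O (fst_of n)) &&
      mem (event O) (fst_of n) (S (fst_of (snd_of (G i n)))))).
    { unfold mem, kills, target, kept.
      repeat (comp; try lazymatch goal with
      | |- decidable _ (fun i n => event O (@?F i n)) => apply (decidable_comp _ _ F Hev)
      | |- computable _ (fun i n => stage_code O (@?F i n)) =>
          apply (computable_stage_code _ _ HO F)
      | |- computable _ (fun i n => G i (@?F i n)) => apply (computable_comp _ _ F HG)
      end). }
    destruct Hdec as [e He]. exists e. intros S Hsub Hinf n.
    set (i := exist _ S (conj Hsub Hinf) : infinite_subset).
    specialize (He i n). change (subset_oracle i) with S in He.
    specialize (HB i n). rewrite fst_pair, snd_pair in HB.
    rewrite !andb_true_iff, negb_true_iff, Nat.ltb_lt, Nat.leb_le in HB.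
    destruct HB as [[[[H1 H2] H3] H4] H5].
    pose proof (survives_from_pair O (fst_of n) _ _ H4 H3 (proj2 (subset_element i _ H1))
                  (proj2 (subset_element i _ H2)) H5) as Hiff.
    rewrite (HA n), Hiff, <- Nat.eqb_eq, <- andb_true_iff.
    destruct (andb _ _); split; intros H; easy.
Qed.

End WellFounded.

(** Dependent choice: below an inaccessible element there is another one. *)
Lemma descending_sequence {T : Type} (R : T -> T -> Prop) :
  ~ well_founded R -> exists d : nat -> T, forall i, R (d (S i)) (d i).
Proof.
  intros H. apply not_all_ex_not in H. destruct H as [x0 Hx0].
  assert (Hnext : forall x : {x | ~ Acc R x}, exists y : {x | ~ Acc R x},
            R (proj1_sig y) (proj1_sig x)).
  { intros [x Hx]. apply NNPP. intros N. apply Hx. constructor. intros y Hy.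
    apply NNPP. intros HA. apply N. now exists (exist _ y HA). }
  set (next x := proj1_sig (constructive_indefinite_description _ (Hnext x))).
  exists (fun i => proj1_sig (Nat.iter i next (exist _ x0 Hx0))).
  intros i. simpl. unfold next at 1.
  now destruct (constructive_indefinite_description _ _).
Qed.

(** * Ill-founded orderings *)

Section IllFounded.

Variable le : nat -> nat -> bool.
Hypothesis Hle : is_linear_order le.
Variable d : nat -> nat.
Hypothesis Hd : forall i, strict le (d (S i)) (d i).
Notation O := (order_oracle le).

Variable A : nat -> Prop.
Hypothesis HA : forall n, A n <-> n = stage_code O (fst_of n) /\ survives O (fst_of n).

Lemma setle_refl u : setle O u u = true.
Proof. unfold setle. now rewrite Nat.eqb_refl. Qed.

Lemma setle_cases u v : setle O u v = true <-> u = v \/ setlt O u v = true.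
Proof. unfold setle. now rewrite orb_true_iff, Nat.eqb_eq. Qed.

Lemma setlt_setle_trans u v w :
  setlt O u v = true -> setle O v w = true -> setlt O u w = true.
Proof.
  intros H1 [<-|H2]%setle_cases; [easy|]. now apply (setlt_trans le Hle) with v.
Qed.

Lemma setle_trans u v w : setle O u v = true -> setle O v w = true -> setle O u w = true.
Proof.
  intros [->|H1]%setle_cases H2; [easy|].
  apply setle_cases. right. now apply setlt_setle_trans with v.
Qed.

Lemma finite_good_le K b b' : setle O b' b = true -> finite_good O K b -> finite_good O K b'.
Proof.
  intros Hb [[G1 G2 G3 G4] HK]. split; [|easy]. split; auto.
  intros k Hk. now apply setle_trans with b, G3.
Qed.

Lemma setbit_spec u a c : Nat.testbit (Nat.setbit u a) c = (a =? c) || Nat.testbit u c.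
Proof. apply Nat.setbit_eqb. Qed.

Lemma setlt_intro a u v :
  Nat.testbit v a = true -> Nat.testbit u a = false ->
  (forall c, Nat.testbit u c = Nat.testbit v c \/ le c a = true) -> setlt O u v = true.
Proof. intros H1 H2 H3. apply setlt_iff. now exists a. Qed.

(* [base] is a finite set all of whose elements are above [d level]; the labels still to
   come lie in the interval from [base] to [base] with [d level] added. *)
Record condition := Condition { finite_part : nat; bound : nat; base : nat; level : nat }.

(** The finite part has labels at or above the upper end of the interval, so a later label strictly
    below that end continues the descent. *)
Record coherent (c : condition) : Prop := {
  coherent_good : finite_good O (finite_part c) (Nat.setbit (base c) (d (level c)));
  coherent_bound : forall k, Nat.testbit (finite_part c) k = true -> k < bound c;
  coherent_base : forall a, Nat.testbit (base c) a = true -> strict le (d (level c)) a }.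

Record extends (c c' : condition) : Prop := {
  extends_bound : bound c <= bound c';
  extends_agree : forall k, k < bound c ->
    Nat.testbit (finite_part c') k = Nat.testbit (finite_part c) k;
  extends_base : setle O (base c) (base c') = true }.

Lemma extends_refl c : extends c c.
Proof. split; [easy|easy|apply setle_refl]. Qed.

Lemma extends_trans c1 c2 c3 : extends c1 c2 -> extends c2 c3 -> extends c1 c3.
Proof.
  intros [A1 A2 A3] [B1 B2 B3]. split.
  - lia.
  - intros k Hk. rewrite B2 by lia. now apply A2.
  - now apply setle_trans with (base c2).
Qed.

Definition stage_set_oracle (S : nat -> bool) (n : nat) : bool :=
  S (fst_of n) && (n =? stage_code O (fst_of n)).

Lemma finite_oracle_agree S K u :
  (forall k, k < u -> Nat.testbit K k = S k) ->
  forall n, n < u -> finite_oracle O K n = stage_set_oracle S n.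
Proof.
  intros H n Hn. unfold finite_oracle, stage_set_oracle.
  pose proof (fst_of_le n). now rewrite H by lia.
Qed.

(** Quantifies over all [S] that further conditions could still build: they agree with the finite
    part, and their initial segments are those of good finite sets with labels at least [base c].
    Hence it is inherited by extensions. *)
Definition defeats (j : nat) (c : condition) : Prop :=
  forall (e : code) (S : nat -> bool),
    enc e = j ->
    (forall k, k < bound c -> Nat.testbit (finite_part c) k = S k) ->
    (forall u, exists K, finite_good O K (base c) /\
       (forall k, k < bound c + u -> Nat.testbit K k = S k)) ->
    ~ computes_with e (stage_set_oracle S) A.

Lemma defeats_extends j c c' : extends c c' -> defeats j c -> defeats j c'.
Proof.
  intros [E1 E2 E3] H e S He HS Happrox. apply H; [easy| |].
  - intros k Hk. rewrite <- E2 by easy. apply HS. lia.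
  - intros u. destruct (Happrox u) as [K [HK Hagree]]. exists K. split.
    + now apply finite_good_le with (base c').
    + intros k Hk. apply Hagree. lia.
Qed.

Lemma d_notin c : coherent c -> Nat.testbit (base c) (d (level c)) = false.
Proof.
  intros Hc. destruct (Nat.testbit _ _) eqn:E; [|easy].
  now apply (coherent_base c Hc) in E as [_ E].
Qed.

Lemma level_base c a : coherent c -> Nat.testbit (base c) a = true ->
  strict le (d (S (level c))) a.
Proof.
  intros Hc Ha. apply (le_strict_trans le Hle) with (d (level c)); [apply Hd|].
  now apply (coherent_base c Hc).
Qed.

Lemma next_label_lt c :
  coherent c ->
  setlt O (Nat.setbit (base c) (d (S (level c)))) (Nat.setbit (base c) (d (level c))) = true.
Proof.
  intros Hc. destruct (Hd (level c)) as [H1 H2]. apply (setlt_intro (d (level c))).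
  - now rewrite setbit_spec, Nat.eqb_refl.
  - now rewrite setbit_spec, (proj2 (Nat.eqb_neq _ _) H2), d_notin.
  - intros a. rewrite !setbit_spec.
    destruct (Nat.eqb_spec (d (S (level c))) a) as [<-|]; [now right|].
    destruct (Nat.eqb_spec (d (level c)) a) as [<-|]; [right; now apply le_refl|now left].
Qed.

(** The label [b] splits the interval. If an event with labels at least [b] errs about its target,
    take its kept set and continue below [b]; if there is none, retreat for good to labels from [b]
    upward. *)
Lemma defeat j c : coherent c -> exists c', coherent c' /\ extends c c' /\ defeats j c'.
Proof.
  intros Hc. set (b := Nat.setbit (base c) (d (S (level c)))).
  assert (Hbase : setle O (base c) b = true).
  { apply setle_cases. right. apply (setlt_intro (d (S (level c)))).
    - unfold b. now rewrite setbit_spec, Nat.eqb_refl.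
    - destruct (Nat.testbit _ _) eqn:E; [|easy].
      now apply (level_base c _ Hc) in E as [_ E].
    - intros a. unfold b. rewrite setbit_spec.
      destruct (Nat.eqb_spec (d (S (level c))) a) as [<-|]; [|now left].
      right. now apply le_refl. }
  destruct (requirement O j (finite_part c) (bound c) b)
    as [(x & Hx & Hno)|(x & K & n & Hx & HK & Hagree & Hrun)].
  (* [d (S (level c))] now belongs to the base, so the level must move past it. *)
  - exists (Condition (finite_part c) (bound c) b (S (S (level c)))). split; [|split].
    + split; simpl.
      * apply finite_good_le with (2 := coherent_good c Hc).
        apply setle_cases. right. destruct (Hd (level c)) as [H1 H2].
        assert (H3 : strict le (d (S (S (level c)))) (d (level c))).
        { apply (le_strict_trans le Hle) with (d (S (level c))); [apply Hd|easy]. }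
        destruct H3 as [H3 H4]. apply (setlt_intro (d (level c))).
        -- now rewrite setbit_spec, Nat.eqb_refl.
        -- unfold b. rewrite !setbit_spec, d_notin by easy.
           now rewrite (proj2 (Nat.eqb_neq _ _) H2), (proj2 (Nat.eqb_neq _ _) H4).
        -- intros a. unfold b. rewrite !setbit_spec.
           destruct (Nat.eqb_spec (d (S (S (level c)))) a) as [<-|]; [now right|].
           destruct (Nat.eqb_spec (d (S (level c))) a) as [<-|]; [now right|].
           destruct (Nat.eqb_spec (d (level c)) a) as [<-|]; [right; now apply le_refl|now left].
      * apply (coherent_bound c Hc).
      * intros a. unfold b. rewrite setbit_spec, orb_true_iff, Nat.eqb_eq.
        intros [<-|Ha]; [apply Hd|].
        apply (le_strict_trans le Hle) with (d (S (level c))); [apply Hd|].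
        now apply level_base.
    + split; simpl; [lia|easy|easy].
    + intros e S <- HS Happrox Hcomp. simpl in *.
      assert (Hev : eval (stage_set_oracle S) e (stage_code O x) 1).
      { apply (Hcomp (stage_code O x)), HA. now rewrite fst_stage_code. }
      destruct (reaches_eval _ _ _ _ Hev 0) as [n Hn].
      (* A correct answer about the survivor [x] has finite use, hence would also be given by a good
         finite [K]. *)
      destruct (run_use (stage_set_oracle S) n (enter (enc e) (stage_code O x) 0)) as [u Hu].
      destruct (Happrox u) as [K [HK Hagree]].
      apply (Hno K n HK).
      * intros k Hk. rewrite Hagree by lia. symmetry. now apply HS.
      * rewrite Hu; [easy|]. apply finite_oracle_agree. intros k Hk. apply Hagree. lia.
  - destruct (run_use (finite_oracle O K) n (enter j (stage_code O x) 0)) as [u Hu].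
    (* The new bound covers the use of the wrong computation and, since the digits of [K] sit at
       positions below [K], all of [K]. *)
    exists (Condition K (bound c + u + K) (base c) (S (level c))). split; [|split].
    + split; simpl; [easy| |].
      * intros k Hk%testbit_lt. lia.
      * intros a Ha. now apply level_base.
    + split; simpl; [lia|easy|apply setle_refl].
    + intros e S He HS _ Hcomp. simpl in *.
      assert (Hev : eval (stage_set_oracle S) e (stage_code O x) 0).
      { apply (Hcomp (stage_code O x)). rewrite HA, fst_stage_code. tauto. }
      assert (0 = 1); [|easy].
      apply (reaches_halt_unique (stage_set_oracle S) (enter j (stage_code O x) 0)).
      * rewrite <- He. now apply reaches_eval.
      * exists n. rewrite Hu; [easy|]. intros i Hi. symmetry.
        apply finite_oracle_agree with (u := u); [|easy]. intros k Hk. apply HS. lia.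
Qed.

(** Adding [d (S (level c))] to the base gives a label inside the interval, which recurs past every
    bound; the next interval ends at that label. *)
Lemma add_element c : coherent c ->
  exists c' n, coherent c' /\ extends c c' /\
    bound c <= n < bound c' /\ Nat.testbit (finite_part c') n = true.
Proof.
  intros Hc.
  destruct (label_unbounded O (Nat.setbit (base c) (d (S (level c)))) (bound c))
    as (n & Hn & Hodd & Ha & Hlab).
  exists (Condition (Nat.setbit (finite_part c) n) (S n) (base c) (S (level c))), n.
  destruct (coherent_good c Hc) as [[G1 G2 G3 G4] HK].
  pose proof (next_label_lt c Hc) as Hlt. split; [|split; [|split]]; simpl.
  - split; simpl.
    + split; [split|]; intros k; try rewrite setbit_spec, orb_true_iff, Nat.eqb_eq.
      * intros [<-|Hk]; auto.
      * easy.
      * intros [<-|Hk]; [rewrite Hlab; apply setle_refl|].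
        apply setle_cases. right. apply setlt_setle_trans with (1 := Hlt). now apply G3.
      * intros j Hj. rewrite !setbit_spec, !orb_true_iff, !Nat.eqb_eq.
        intros [<-|Hk] [<-|Hk'].
        -- lia.
        -- pose proof (coherent_bound c Hc j Hk'). lia.
        -- rewrite Hlab. apply setlt_setle_trans with (1 := Hlt). now apply G3.
        -- now apply G4.
      * intros [<-|Hk]; auto.
    + intros k. rewrite setbit_spec, orb_true_iff, Nat.eqb_eq. intros [<-|Hk]; [lia|].
      pose proof (coherent_bound c Hc k Hk). lia.
    + intros a Ha'. now apply level_base.
  - split; simpl; [lia| |apply setle_refl]. intros k Hk. rewrite setbit_spec.
    destruct (Nat.eqb_spec n k); [lia|easy].
  - lia.
  - now rewrite setbit_spec, Nat.eqb_refl.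
Qed.

(** * The generic sequence of conditions *)

Definition progress (j : nat) (c c' : condition) : Prop :=
  extends c c' /\ defeats j c' /\
  exists n, bound c <= n < bound c' /\ Nat.testbit (finite_part c') n = true.

Lemma progress_exists j (c : {c | coherent c}) :
  exists c' : {c | coherent c}, progress j (proj1_sig c) (proj1_sig c').
Proof.
  destruct c as [c Hc].
  destruct (defeat j c Hc) as (c1 & H1 & E1 & D1).
  destruct (add_element c1 H1) as (c2 & n & H2 & E2 & Hn & Hb).
  exists (exist _ c2 H2). split; [|split]; simpl.
  - now apply extends_trans with c1.
  - now apply defeats_extends with c1.
  - exists n. pose proof (extends_bound _ _ E1). split; [lia|easy].
Qed.

Lemma coherent_start : coherent (Condition 0 0 0 0).
Proof.
  split; [split; [split|]|..]; simpl; intros; now rewrite ?Nat.bits_0 in *.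
Qed.

Lemma progress_sequence :
  exists s : nat -> condition, forall j, coherent (s j) /\ progress j (s j) (s (S j)).
Proof.
  set (next j c := proj1_sig (constructive_indefinite_description _ (progress_exists j c))).
  set (s := nat_rect (fun _ => {c | coherent c}) (exist _ _ coherent_start) next).
  exists (fun j => proj1_sig (s j)). intros j. split; [apply proj2_sig|].
  change (s (S j)) with (next j (s j)). unfold next.
  now destruct (constructive_indefinite_description _ _).
Qed.

(** The union of the finite parts is an infinite subset of [A] up to coding, and step [enc e] of the
    sequence ensures that the code [e] fails on it. *)
Lemma ill_founded_not_introreducible : ~ introreducible A.
Proof.
  intros [_ Hintro]. destruct progress_sequence as [s Hs].
  assert (Hext : forall i j, i <= j -> extends (s i) (s j)).
  { intros i j Hij. induction Hij as [|j _ IH]; [apply extends_refl|].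
    apply extends_trans with (1 := IH), Hs. }
  assert (Hbound : forall j, j <= bound (s j)).
  { induction j as [|j IH]; [lia|]. destruct (Hs j) as [_ (_ & _ & n & Hn & _)]. lia. }
  (* Position [k] is read off at condition [S k], whose bound already exceeds [k]. *)
  set (S0 := fun k => Nat.testbit (finite_part (s (S k))) k).
  assert (Hagree : forall j k, k < bound (s j) -> Nat.testbit (finite_part (s j)) k = S0 k).
  { intros j k Hk. unfold S0. destruct (Nat.le_gt_cases j (S k)) as [Hjk|Hjk].
    - symmetry. now apply (extends_agree _ _ (Hext _ _ Hjk)).
    - apply (extends_agree _ _ (Hext (S k) j ltac:(lia))). pose proof (Hbound (S k)). lia. }
  destruct (Hintro (stage_set_oracle S0)) as [e He].
  - intros x Hx. unfold stage_set_oracle in Hx.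
    rewrite andb_true_iff, Nat.eqb_eq in Hx. destruct Hx as [Hx E].
    apply HA. split; [easy|].
    now apply (coherent_good _ (proj1 (Hs (S (fst_of x))))).
  - intros m. destruct (Hs m) as [_ (_ & _ & n & Hn & Hb)].
    pose proof (Hbound m). pose proof (pair_ge n (history O n)).
    exists (stage_code O n). split; [unfold stage_code; lia|].
    unfold stage_set_oracle. rewrite fst_stage_code, Nat.eqb_refl, <- (Hagree (S m)) by lia.
    now rewrite Hb.
  - destruct (Hs (enc e)) as [_ (_ & Hdef & _)].
    apply (Hdef e S0 eq_refl); [apply Hagree| |exact He].
    intros u. set (c := s (S (enc e))).
    set (j := S (enc e) + bound c + u). exists (finite_part (s j)).
    destruct (Hs j) as [Hc _]. split.
    (* Bases only rise, and the labels of each finite part lie above the current base. *)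
    + apply finite_good_le with (2 := coherent_good _ Hc).
      apply setle_trans with (base (s j)); [apply Hext; lia|].
      apply setle_cases. right. apply (setlt_intro (d (level (s j)))).
      * now rewrite setbit_spec, Nat.eqb_refl.
      * now apply d_notin.
      * intros a. rewrite setbit_spec.
        destruct (Nat.eqb_spec (d (level (s j))) a) as [<-|]; [|now left].
        right. now apply le_refl.
    + intros k Hk. apply Hagree. pose proof (Hbound j). lia.
Qed.

End IllFounded.

Theorem theorem1p6 :
  exists e : code,
    forall le : nat -> nat -> bool,
      is_linear_order le ->
      let A := fun n : nat => ~ halts (order_oracle le) e n in
      (well_founded (strict le) -> uniformly_introreducible A) /\
      (~ well_founded (strict le) -> ~ introreducible A).
Proof.
  destruct complement_enumerable as [e He]. exists e. intros le Hle A.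
  assert (HA : forall n, A n <->
    n = stage_code (order_oracle le) (fst_of n) /\ survives (order_oracle le) (fst_of n)).
  { intros n. unfold A. rewrite He. split; [apply NNPP|tauto]. }
  split; intros Hwf.
  - now apply wf_uniformly_introreducible with le.
  - destruct (descending_sequence _ Hwf) as [d Hd].
    now apply ill_founded_not_introreducible with le d.
Qed.
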